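(* Let $\Gamma=\mathrm{SO}_3(\mathbb{Z}[i])$ and let $\mathbf{c}^{-1}(\Gamma)\subset\mathrm{SL}_2(\mathbb{C})$ be its preimage; let $\mathbf c^{-1}(\Gamma_{\mathbb Z})=\mathbf c^{-1}(\Gamma)\cap\mathrm{SL}_2(\mathbb{R})$. Let $\mu$ denote a Haar measure on $\mathrm{SL}_2(\mathbb{C})$, respectively on $\mathrm{SL}_2(\mathbb{R})$, and also the induced measure on quotients by discrete subgroups. Then $$\mu\bigl(\mathbf c^{-1}(\Gamma)\backslash\mathrm{SL}_2(\mathbb{C})\bigr)=\tfrac12\,\mu\bigl(\mathrm{SL}_2(\mathbb{Z}[i])\backslash\mathrm{SL}_2(\mathbb{C})\bigr),$$ $$\mu\bigl(\mathbf c^{-1}(\Gamma_{\mathbb Z})\backslash\mathrm{SL}_2(\mathbb{R})\bigr)=\tfrac32\,\mu\bigl(\mathrm{SL}_2(\mathbb{Z})\backslash\mathrm{SL}_2(\mathbb{R})\bigr).$$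
   Context: For $g\in \mathrm{SL}_2(\mathbb{C})$, $\mathbf{c}(g)$ is the matrix of $X\mapsto gXg^{-1}$ on $\mathfrak{sl}_2(\mathbb{C})$ with respect to the basis $X_1=\begin{pmatrix}0&1\\1&0\end{pmatrix}$, $X_2=\begin{pmatrix}0&i\\-i&0\end{pmatrix}$, $Y=\begin{pmatrix}1&0\\0&-1\end{pmatrix}$, orthonormal for $\frac12\mathrm{Tr}(XY)$; $\mathbf c:\mathrm{SL}_2(\mathbb{C})\to\mathrm{SO}_3(\mathbb{C})$ is surjective with kernel $\{\pm I\}$. $\mathrm{SO}_3(\mathbb{Z}[i])$ consists of the matrices of $\mathrm{SO}_3(\mathbb{C})$ with entries in $\mathbb{Z}[i]$, and $\Gamma_{\mathbb Z}:=\mathbf c(\mathrm{SL}_2(\mathbb{R})\cap\mathbf c^{-1}(\Gamma))$. The formulas hold for any normalization of Haar measure. *)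

(* Defs.v *)
From HB Require Import structures.
From mathcomp Require Import all_boot all_order all_algebra generic_quotient.
From mathcomp Require Import complex.
From mathcomp Require Import all_classical all_reals all_analysis.

Set Implicit Arguments.
Unset Strict Implicit.
Unset Printing Implicit Defensive.

Import Order.TTheory GRing.Theory Num.Theory.
Import numFieldNormedType.Exports.

Local Open Scope classical_set_scope.
Local Open Scope quotient_scope.
Local Open Scope ring_scope.

(* SL_n(K), with the topology induced from 'M[K]_n. *)
Record SL (K : numFieldType) (n : nat) := MkSL {
  SL_mx :> 'M[K]_n;
  SL_det : \det SL_mx == 1 }.

Section SLTheory.
Variables (K : numFieldType) (n : nat).
Local Notation G := (SL K n).

HB.instance Definition _ := [isSub for @SL_mx K n].
HB.instance Definition _ := [Choice of G by <:].

Fact SL_one_det : \det (1%:M : 'M[K]_n) == 1.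
Proof. by rewrite det1. Qed.

Fact SL_mul_det (g h : G) : \det (g *m h) == 1.
Proof. by rewrite det_mulmx (eqP (SL_det g)) (eqP (SL_det h)) mulr1. Qed.

Fact SL_inv_det (g : G) : \det (invmx g) == 1.
Proof. by rewrite det_inv (eqP (SL_det g)) invr1. Qed.

Fact SL_unitmx (g : G) : (g : 'M[K]_n) \in unitmx.
Proof. by rewrite unitmxE (eqP (SL_det g)) unitr1. Qed.

Definition SL_one : G := MkSL SL_one_det.
Definition SL_mul (g h : G) : G := MkSL (SL_mul_det g h).
Definition SL_inv (g : G) : G := MkSL (SL_inv_det g).

Fact SL_mulA : associative SL_mul.
Proof. by move=> f g h; apply/val_inj/mulmxA. Qed.

Fact SL_mul1 : left_id SL_one SL_mul.
Proof. by move=> g; apply/val_inj/mul1mx. Qed.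

Fact SL_mulr1 : right_id SL_one SL_mul.
Proof. by move=> g; apply/val_inj/mulmx1. Qed.

Fact SL_mulV : left_inverse SL_one SL_inv SL_mul.
Proof. by move=> g; apply/val_inj/mulVmx/SL_unitmx. Qed.

Fact SL_mulrV : right_inverse SL_one SL_inv SL_mul.
Proof. by move=> g; apply/val_inj/mulmxV/SL_unitmx. Qed.

HB.instance Definition _ :=
  isGroup.Build G SL_mulA SL_mul1 SL_mulr1 SL_mulV SL_mulrV.
HB.instance Definition _ :=
  Topological.copy G (initial_topology (@SL_mx K n)).
HB.instance Definition _ := isPointed.Build G 1%g.

End SLTheory.

(* The embedding SL_n(R) -> SL_n(C). *)
Fact SL_complex_det (R : realType) (n : nat) (g : SL R n) :
  \det (map_mx (real_complex R) g) == 1.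
Proof. by rewrite det_map_mx (eqP (SL_det g)) rmorph1. Qed.

Definition SL_complex (R : realType) (n : nat) (g : SL R n) : SL R[i] n :=
  MkSL (SL_complex_det g).

Definition borel (T : ptopologicalType) := g_sigma_algebraType (@open T).

Section Haar.
Variables (R : realType) (K : numFieldType) (n : nat).
Local Notation G := (SL K n).

(* Left Haar measures. When K is R or R[i], G is locally compact and second
   countable, so that the regularity of mu is automatic. *)
Definition haar_measure (mu : {measure set (borel G) -> \bar R}) : Prop :=
  [/\ mu [set: G] != 0%E,
      forall C : set G, compact C -> (mu C < +oo)%E
    & forall (g : G) (A : set G), measurable (A : set (borel G)) ->
        mu [set (g * a)%g | a in A] = mu A].

Section Quotient.
Variable L : set G.

Definition right_coset (g : G) : set G := [set (l * g)%g | l in L].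

Definition right_coset_eq : rel G :=
  fun g h => `[< right_coset g = right_coset h >].

Fact right_coset_eq_refl : reflexive right_coset_eq.
Proof. by move=> g; apply/asboolP. Qed.

Fact right_coset_eq_sym : symmetric right_coset_eq.
Proof. by move=> g h; apply/asboolP/asboolP => ->. Qed.

Fact right_coset_eq_trans : transitive right_coset_eq.
Proof. by move=> g f h /asboolP fg /asboolP gh; apply/asboolP; rewrite fg. Qed.

Canonical right_coset_equiv :=
  EquivRel right_coset_eq right_coset_eq_refl right_coset_eq_sym
    right_coset_eq_trans.

(* L \ G, the space of the right cosets L g, with the quotient topology. *)
Definition left_quotient : ptopologicalType :=
  quotient_topology {eq_quot right_coset_equiv}.

Definition left_quotient_pi (g : G) : left_quotient :=
  \pi_{eq_quot right_coset_equiv} g.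

(* For L a discrete subgroup and mu left invariant, such a nu exists and is
   unique: it is the measure on L \ G for which the projection G -> L \ G is
   locally measure preserving, that is nu (L \ L A) = mu A as soon as the
   translates l A, for l in L, are pairwise disjoint. *)
Definition induced_measure (mu : {measure set (borel G) -> \bar R})
    (nu : {measure set (borel left_quotient) -> \bar R}) : Prop :=
  forall A : set G, measurable (A : set (borel G)) ->
    set_inj A left_quotient_pi -> nu (left_quotient_pi @` A) = mu A.

End Quotient.
End Haar.

Section AdjointMap.
Variable R : realType.
Local Notation C := R[i].
Local Open Scope complex_scope.

Definition mx22 (a b c d : C) : 'M[C]_2 :=
  \matrix_(i, j) nth 0 (nth [::] [:: [:: a; b]; [:: c; d]] i) j.

Definition sl2_X1 : 'M[C]_2 := mx22 0 1 1 0.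
Definition sl2_X2 : 'M[C]_2 := mx22 0 'i (- 'i) 0.
Definition sl2_Y : 'M[C]_2 := mx22 1 0 0 (- 1).

Definition sl2_basis : 3.-tuple 'M[C]_2 := [tuple sl2_X1; sl2_X2; sl2_Y].

(* Hence coord sl2_basis gives the coordinates on the span, sl_2(C). *)
Lemma sl2_basis_free : free sl2_basis.
Proof.
apply/freeP => k; rewrite !big_ord_recr big_ord0 /= add0r => E.
have e (a b : 'I_2) := congr1 (fun M : 'M[R[i]]_2 => M a b) E.
have e00 := e 0 0; have e01 := e 0 1; have e10 := e 1 0.
rewrite !mxE /= !(mulr0,mulr1,addr0,add0r) in e00 e01 e10.
set a := k _ in e01 e10; set b := k _ in e01 e10; set c := k _ in e00.
have i0 : ('i : R[i])%C != 0 by rewrite eq_complex /= oner_eq0 andbF.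
move/eqP: e10; rewrite mulrN subr_eq0 => /eqP ab.
have b0 : b = 0.
  move/eqP: e01; rewrite ab -mulr2n mulrn_eq0 mulf_eq0 (negPf i0) orbF /=.
  by move/eqP.
have a0 : a = 0 by rewrite ab b0 mul0r.
by case=> [[|[|[|//]]] lti]; [rewrite -a0|rewrite -b0|rewrite -e00];
  congr (k _); exact/val_inj.
Qed.

(* The matrix of X |-> g X g^-1, acting on column vectors: column k consists of
   the coordinates of the image of the k-th basis vector. *)
Definition cmx (g : SL C 2) : 'M[C]_3 :=
  \matrix_(j, k) coord sl2_basis j (g *m sl2_basis`_k *m invmx g).

Definition gaussian_int : set C :=
  [set z | complex.Re z \is a Num.int /\ complex.Im z \is a Num.int].

Definition SO3 : set 'M[C]_3 := [set A | A *m A^T = 1%:M /\ \det A = 1].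

Definition SO3_gauss : set 'M[C]_3 :=
  SO3 `&` [set A | forall j k, gaussian_int (A j k)].

Definition SL2_gauss : set (SL C 2) :=
  [set g | forall j k, gaussian_int (g j k)].

Definition SL2_int : set (SL R 2) := [set g | forall j k, g j k \is a Num.int].

(* Gamma_Z = c(SL_2(R) `&` c^-1(Gamma)) for Gamma = SO_3(Z[i]). *)
Definition Gamma_int : set 'M[C]_3 :=
  cmx @` (range (@SL_complex R 2) `&` cmx @^-1` SO3_gauss).

Definition cinv_Gamma : set (SL C 2) := cmx @^-1` SO3_gauss.

Definition cinv_Gamma_int : set (SL R 2) :=
  @SL_complex R 2 @^-1` (cmx @^-1` Gamma_int).

Lemma cinv_Gamma_intE : cinv_Gamma_int = @SL_complex R 2 @^-1` cinv_Gamma.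
Proof.
apply/seteqP; split=> [g [h [_ Gh] eq_hg]|g Gg].
  by rewrite /cinv_Gamma /= -eq_hg.
by exists (SL_complex g) => //; split=> //; exists g.
Qed.

End AdjointMap.

Arguments cinv_Gamma R : clear implicits.
Arguments cinv_Gamma_int R : clear implicits.
Arguments SL2_gauss R : clear implicits.
Arguments SL2_int R : clear implicits.

(* Main.v *)
Require Import Defs.
From HB Require Import structures.
From mathcomp Require Import all_boot all_order all_algebra generic_quotient.
From mathcomp Require Import complex ring lra zify.
From mathcomp Require Import all_classical all_reals all_analysis.

Set Implicit Arguments.
Unset Strict Implicit.
Unset Printing Implicit Defensive.

Import Order.TTheory GRing.Theory Num.Theory.
Import numFieldNormedType.Exports.

Local Open Scope classical_set_scope.
Local Open Scope ring_scope.

(* The induced measure of L \ G is the Haar measure of any Borel set F of exact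
   representatives of L \ G. If L is the disjoint union of the cosets L' t_i,
   the union of the t_i F is such a set for L', and h F is one for h L h^-1, so
   left invariance alone reduces the theorem to index computations.

   Put O = Z[i] and let h be a determinant one multiple of the matrix with
   columns (1,1) and (0,1+i). Then c(g) has entries in O if and only if all
   pairwise products of the entries of h^-1 g h are in O, and since O is
   Euclidean this means that these entries are all in O or all in zeta O, where
   zeta^2 = i. So h^-1 c^-1(Gamma) h contains SL_2(O) with index 2. The real
   elements of the first kind form the theta group, the matrices of SL_2(Z) whose
   entries have an even sum, of index 3 in SL_2(Z); those of the second kind form
   one further coset of it, that of the rotation by pi/4. *)

(** * Exact fundamental sets of discrete subgroups *)

Section FundamentalSets.
Variables (K : numFieldType) (n : nat).
Local Notation G := (SL K n).
Implicit Types (L F A : set G) (g h l : G).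

Definition subgroup L := L 1%g /\ forall x y, L x -> L y -> L (x * y^-1)%g.

Lemma subgroupV L x : subgroup L -> L x -> L (x^-1)%g.
Proof. by case=> L1 LM Lx; rewrite -[(x^-1)%g]mul1g; apply: LM. Qed.

Lemma subgroupM L x y : subgroup L -> L x -> L y -> L (x * y)%g.
Proof.
by move=> sL Lx Ly; rewrite -[y]invgK; apply: sL.2 => //; apply: subgroupV.
Qed.

(** Representatives are exact, without boundary identifications, so that no null sets have to be
    discarded later. *)
Definition fundamental_set L F :=
  [/\ measurable (F : set (borel G)),
      forall g, exists2 l, L l & F (l * g)%g
    & forall x y, F x -> F y -> L (x * y^-1)%g -> x = y].

(** The projection to L \ G is injective on F and maps F onto the quotient, so the defining property
    of [nu] applied to F gives the total mass. *)
Lemma induced_measureT (R : realType) L F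
    (mu : {measure set (borel G) -> \bar R})
    (nu : {measure set (borel (left_quotient L)) -> \bar R}) :
  subgroup L -> fundamental_set L F -> induced_measure mu nu ->
  nu setT = mu F.
Proof.
move=> sL [mF surF injF] ind.
have pi_eq x y : left_quotient_pi L x = left_quotient_pi L y -> L (x * y^-1)%g.
  move=> /eqmodP /asboolP e.
  have : right_coset L x x by exists 1%g; [exact: sL.1|rewrite mul1g].
  by rewrite e => -[l Ll <-]; rewrite mulgK.
have eq_pi l y : L l -> left_quotient_pi L (l * y)%g = left_quotient_pi L y.
  move=> Ll; apply/eqmodP/asboolP/seteqP; split=> _ [x Lx <-].
    by exists (x * l)%g; [exact: subgroupM|rewrite mulgA].
  exists (x * l^-1)%g; first exact: sL.2.
  by rewrite -mulgA mulKg.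
rewrite -ind //; last first.
  by move=> x y /set_mem Fx /set_mem Fy /pi_eq; apply: injF.
congr (nu _); apply/seteqP; split=> // q _.
have [l Ll Fl] := surF (repr q).
by exists (l * repr q)%g => //; rewrite eq_pi // /left_quotient_pi reprK.
Qed.

Lemma SL_mull_continuous g : continuous (fun x : G => (g * x)%g).
Proof.
apply: continuous_comp_initial.
have entryc i j : continuous (fun M : 'M[K]_n => (SL_mx g *m M) i j).
  under eq_fun do rewrite mxE.
  apply: continuous_big => [|k _ M]; first exact: add_continuous.
  by apply: cvgMl_tmp; [exact: (nbhs_filter M)|exact: coord_continuous].
have mulmxc : continuous (mulmx g : 'M[K]_n -> 'M[K]_n).
  (* A neighbourhood of a matrix contains a product of neighbourhoods [P i j] of its entries;
     finitely many entrywise conditions then hold simultaneously. *)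
  move=> M B [P nP sub].
  have : \forall N \near M, forall ij : 'I_n * 'I_n,
      P ij.1 ij.2 ((SL_mx g *m N) ij.1 ij.2).
    apply: (@filter_forall _ ('I_n * 'I_n)%type
      (fun ij N => P ij.1 ij.2 ((SL_mx g *m N) ij.1 ij.2)) (nbhs M) _) => -[i j].
    by apply: entryc; apply: nP.
  by apply: filterS => N PN; apply: sub => i j; apply: (PN (i, j)).
move=> x; apply: (@cvg_comp _ _ _ (@SL_mx K n) (mulmx g) _ _ _ _ (mulmxc (SL_mx x))).
exact: initial_continuous.
Qed.

Lemma image_mulg g A : [set (g * a)%g | a in A] = [set x | A (g^-1 * x)%g].
Proof.
apply/seteqP; split=> [_ [a Aa <-] /=|x /= Ax]; first by rewrite mulKg.
by exists (g^-1 * x)%g => //; rewrite mulVKg.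
Qed.

Lemma open_mulg g A : open A -> open [set (g * a)%g | a in A].
Proof.
rewrite image_mulg => oA.
by apply: open_comp => // x _; apply: SL_mull_continuous.
Qed.

Lemma measurable_mulg g A : measurable (A : set (borel G)) ->
  measurable ([set (g * a)%g | a in A] : set (borel G)).
Proof.
rewrite image_mulg => mA.
have mf : measurable_fun setT ((fun x => (g^-1 * x)%g) : borel G -> borel G).
  apply: (@measurability _ _ (borel G) (borel G) setT _ (@open G)) => // _ [B oB <-].
  rewrite setTI; apply: sub_sigma_algebra; apply: open_comp => // x _.
  exact: SL_mull_continuous.
by rewrite -[X in measurable X]setTI; apply: mf.
Qed.

(** Here L' is h L h^-1. The set h F, rather than h F h^-1, is used because left invariance gives it
    the measure of F. *)
Lemma fundamental_set_conj L L' F h :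
  (forall x, L' x <-> L (h^-1 * x * h)%g) -> fundamental_set L F ->
  fundamental_set L' [set (h * a)%g | a in F].
Proof.
move=> LL' [mF surF injF]; split; first exact: measurable_mulg.
- move=> g; have [l Ll Fl] := surF (h^-1 * g)%g.
  exists (h * l * h^-1)%g; first by rewrite LL' !mulgA mulVg mul1g mulgVK.
  by exists (l * (h^-1 * g))%g; rewrite // !mulgA.
- move=> _ _ [x Fx <-] [y Fy <-]; rewrite LL' invgM => Lxy.
  by rewrite (injF x y) // -[X in L X]mulg1 -(mulVg h); rewrite !mulgA in Lxy *;
    rewrite mulVg mul1g in Lxy.
Qed.

(** The [t i] represent the cosets L' t_i in L. If l g is in F and l^-1 lies in L' t_i, then t_i l
    is in L' and carries g into t_i F. *)
Lemma fundamental_set_cosets L L' F (t : nat -> G) m :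
    subgroup L -> subgroup L' -> L' `<=` L -> fundamental_set L F ->
    (forall i, (i < m)%N -> L (t i)) ->
    (forall l, L l -> exists2 i, (i < m)%N & L' (l * (t i)^-1)%g) ->
    (forall i j, (i < m)%N -> (j < m)%N -> L' (t i * (t j)^-1)%g -> i = j) ->
  fundamental_set L' (\bigcup_(i in `I_m) [set (t i * a)%g | a in F]).
Proof.
move=> sL sL' L'L [mF surF injF] Lt covt tinj; split.
- apply: (@bigcup_measurable _ (borel G)) => i _; exact: measurable_mulg.
- move=> g; have [l Ll Fl] := surF g.
  have [i im L'i] := covt _ (subgroupV sL Ll).
  exists (t i * l)%g; first by rewrite -[(_ * _)%g]invgK invgM; exact: subgroupV.
  by exists i => //; exists (l * g)%g; rewrite // mulgA.
- move=> _ _ [i im [x Fx <-]] [j jm [y Fy <-]] L'xy.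
  have xy : x = y.
    apply: injF => //.
    have -> : (x * y^-1 = (t i)^-1 * (t i * x * (t j * y)^-1) * t j)%g.
      by rewrite invgM !mulgA mulVg mul1g mulgVK.
    apply: (subgroupM sL); last exact: Lt.
    apply: (subgroupM sL); last exact: L'L.
    by apply: (subgroupV sL); apply: Lt.
  rewrite xy; move: L'xy; rewrite xy invgM mulgA mulgK => /tinj.
  by move=> /(_ im jm) ->.
Qed.

(** * Fundamental sets under a left invariant measure *)

Section LeftInvariant.
Variables (R : realType) (mu : {measure set (borel G) -> \bar R}).
Hypothesis mu_left : forall g A, measurable (A : set (borel G)) ->
  mu [set (g * a)%g | a in A] = mu A.

(** The translates t_i F are pairwise disjoint, because F contains only one point of each coset of
    L. *)
Lemma measure_cosets L F (t : nat -> G) m :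
    subgroup L -> fundamental_set L F -> (forall i, (i < m)%N -> L (t i)) ->
    (forall i j, (i < m)%N -> (j < m)%N -> t i = t j -> i = j) ->
  mu (\bigcup_(i in `I_m) [set (t i * a)%g | a in F]) = (\sum_(i < m) mu F)%E.
Proof.
move=> sL [mF surF injF] Lt tinj.
rewrite (@measure_fin_bigcup _ _ _ mu) //; last 2 first.
- move=> i j im jm [_ [[x Fx <-] [y Fy xy]]].
  have xy' : x = y.
    apply: injF => //; rewrite -[x](mulKg (t i)) -xy mulgA mulgK.
    by apply: (subgroupM sL); [apply: (subgroupV sL)|]; apply: Lt.
  by apply: tinj => //; move: xy; rewrite xy' => /mulIg.
- move=> i _; exact: measurable_mulg.
rewrite -fsbig_ord; apply: eq_bigr => i _; exact: mu_left.
Qed.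

(* Both sides equal the sum over l in L of mu (F1 `&` l^-1 F2). *)
Lemma measure_fundamental_set L F1 F2 : subgroup L -> countable L ->
  fundamental_set L F1 -> fundamental_set L F2 -> mu F1 = mu F2.
Proof.
move=> sL /countable_injP[f finj] [mF1 surF1 injF1] [mF2 surF2 injF2].
pose e k := get [set l | L l /\ f l = k].
have eP k : (f @` L) k -> L (e k) /\ f (e k) = k.
  by case=> l Ll fl; apply: (@getPex _ [set l | L l /\ f l = k]); exists l.
have eK l : L l -> e (f l) = l.
  move=> Ll; have [|Le fe] := eP (f l); first by exists l.
  by apply: finj => //; apply/mem_set.
pose B k := F1 `&` [set ((e k)^-1 * a)%g | a in F2].
have mB k : measurable (B k : set (borel G)).
  by apply: measurableI => //; apply: measurable_mulg.
have BE k x : B k x <-> F1 x /\ F2 (e k * x)%g.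
  by rewrite /B image_mulg invgK.
have defF1 : F1 = \bigcup_(k in f @` L) B k.
  apply/seteqP; split=> [x F1x|x [k _ []//]].
  have [l Ll Fl] := surF2 x.
  by exists (f l); [exists l|apply/BE; rewrite eK].
have defF2 : F2 = \bigcup_(k in f @` L) [set (e k * a)%g | a in B k].
  apply/seteqP; split=> [x F2x|x [k Lk [y /BE[_ ?] <-//]]].
  have [l Ll Fl] := surF1 x; have LV := subgroupV sL Ll.
  exists (f l^-1%g); first by exists l^-1%g.
  exists (l * x)%g; last by rewrite eK // mulKg.
  by apply/BE; split=> //; rewrite eK // mulKg.
rewrite [in LHS]defF1 [in RHS]defF2 !measure_bigcup //.
- by apply: eq_eseriesr => k _; rewrite mu_left.
- move=> k _; exact: measurable_mulg.
- move=> i j /eP[Li fi] /eP[Lj fj] [x [[a /BE[Fa _] <-] [b /BE[Fb _] ab]]].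
  have ? : a = b.
    apply: injF1 => //; rewrite -[a](mulKg (e i)) -ab mulgA mulgK.
    by apply: (subgroupM sL) => //; apply: (subgroupV sL).
  by subst b; move: ab => /mulIg eij; rewrite -fi -fj eij.
- move=> i j /eP[Li fi] /eP[Lj fj] [x [/BE[_ Fi] /BE[_ Fj]]].
  rewrite -fi -fj; congr f; apply: (mulIg x); apply: injF2 => //.
  by rewrite invgM mulgA mulgK; apply: sL.2.
Qed.

End LeftInvariant.

(** * Existence of Borel fundamental sets for discrete subgroups *)

Section Existence.

Lemma cvg_det (T : Type) (F : set_system T) (FF : Filter F) m
    (M : T -> 'M[K]_m) (A : 'M[K]_m) :
  (forall i j, M x i j @[x --> F] --> A i j) ->
  \det (M x) @[x --> F] --> \det A.
Proof.
move=> MA; rewrite /determinant; apply: cvg_big; first exact: add_continuous.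
move=> s _; apply: cvgMl_tmp; apply: cvg_big => //; exact: mul_continuous.
Qed.

Lemma cvg_SL_entry g i j : (x : G) i j @[x --> g] --> g i j.
Proof.
apply: (@continuous_comp _ _ _ (@SL_mx K n) (fun M => M i j)).
  exact: initial_continuous.
exact: coord_continuous.
Qed.

(** Since the determinant is one, the inverse is the adjugate, whose entries are polynomials in
    those of the matrix. *)
Lemma cvg_SL_div g i j :
  (z.1 * z.2^-1 : G)%g i j @[z --> (g, g)] --> (1%g : G) i j.
Proof.
rewrite -(mulgV g) /=.
have invE (x : G) : invmx x = \adj x :> 'M[K]_n.
  by rewrite /invmx SL_unitmx (eqP (SL_det x)) invr1 scale1r.
rewrite mxE; under eq_cvg do rewrite mxE.
apply: cvg_big => [|k _]; first exact: add_continuous.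
apply: cvgM.
  apply: (@cvg_comp _ _ _ fst (fun x : G => x i k)); first exact: cvg_fst.
  exact: cvg_SL_entry.
rewrite invE mxE; under eq_cvg do rewrite invE mxE.
apply: cvgMl_tmp; apply: cvg_det => a b; rewrite !mxE.
under eq_cvg do rewrite !mxE.
apply: (@cvg_comp _ _ _ snd (fun x : G => x _ _)); first exact: cvg_snd.
exact: cvg_SL_entry.
Qed.

Hypotheses (T : countType) (q : T -> K).
Hypothesis q_dense : forall x e, 0 < e -> exists t, `|x - q t| < e.

(** A countable basis of open cubes: the centre is a matrix over the dense set, and the radius is
    the absolute value of one more point of it. *)
Let V (j : 'M[T]_n * T) : set G :=
  [set g | forall a b, `|g a b - q (j.1 a b)| < `|q j.2|].

Let V_open j : open (V j).
Proof.
pose B : set 'M[K]_n := [set M | forall a b, ball (q (j.1 a b)) `|q j.2| (M a b)].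
exists B; last first.
  by apply/seteqP; split=> g Vg a b; have := Vg a b; rewrite /= distrC.
rewrite openE => M BM; exists (fun a b => ball (q (j.1 a b)) `|q j.2|).
  by move=> a b; apply: open_nbhs_nbhs; split; [exact: ball_open|exact: BM].
by move=> N.
Qed.

Let V_basis g (U : set G) : nbhs g U -> exists2 j, V j g & V j `<=` U.
Proof.
rewrite nbhsE => -[W [[B oB <-] /= Bg] WU].
have /nbhs_ballP[e e0 Be] : nbhs (SL_mx g) B by exact: open_nbhs_nbhs.
have e40 : 0 < e / 4 by rewrite divr_gt0.
(* Approximating e / 4 within e / 4 gives a radius with 0 < |q t| < e / 2, so a cube of this radius
   that contains g stays within e of g. *)
have [t qt] := q_dense (e / 4) e40.
have qt0 : 0 < `|q t|.
  by rewrite normr_gt0; apply: contraTneq qt => ->; rewrite subr0 gtr0_norm ?ltxx.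
have qte : `|q t| < e / 2.
  have -> : e / 2 = e / 4 + e / 4 by field.
  rewrite -[q t](subKr (e / 4)).
  apply: le_lt_trans (ler_normB _ _) _.
  by rewrite gtr0_norm // ltrD2l.
have /choice[Q hQ] : forall ab : 'I_n * 'I_n, exists s, `|g ab.1 ab.2 - q s| < `|q t|.
  by move=> ab; apply: q_dense.
exists (\matrix_(a, b) Q (a, b), t) => [a b|h Vh].
  by rewrite mxE; apply: (hQ (a, b)).
apply/WU/Be; split=> // a b; rewrite -ball_normE /ball_ /=.
have := Vh a b; rewrite mxE /= distrC => Vab.
have -> : e = e / 2 + e / 2 by field.
rewrite -(subrKA (q (Q (a, b)))); apply: le_lt_trans (ler_normD _ _) _.
by apply: ltrD; apply: lt_trans qte => //; apply: (hQ (a, b)).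
Qed.

(** Discreteness and the countable basis cover G by open sets [U m], none of which contains two
    distinct L-equivalent points. Removing from [U m] the sets L U_k with k < m leaves, of each
    coset of L, exactly its one point in the first [U m] that it meets. *)
Lemma exists_fundamental_set L : subgroup L ->
    (exists2 e, 0 < e & forall l, L l ->
       (forall i j, `|(1%g : G) i j - l i j| < e) -> l = 1%g) ->
  exists F, fundamental_set L F.
Proof.
move=> sL [e e0 Le].
(* For x and y close to g, x y^-1 is close to 1, hence equal to 1 if it lies in L. *)
have loc_inj g : exists2 U, nbhs g U &
    forall x y, U x -> U y -> L (x * y^-1)%g -> x = y.
  have : \forall z \near (g, g), forall ij : 'I_n * 'I_n,
      `|(1%g : G) ij.1 ij.2 - (z.1 * z.2^-1 : G)%g ij.1 ij.2| < e.
    apply: (@filter_forall _ ('I_n * 'I_n)%type (fun ij z =>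
      `|(1%g : G) ij.1 ij.2 - (z.1 * z.2^-1 : G)%g ij.1 ij.2| < e) (nbhs (g, g)) _) => -[i j] /=.
    have /cvgrPdist_lt := @cvg_SL_div g i j.
    exact.
  case=> -[U1 U2] [/= nU1 nU2] sub; exists (U1 `&` U2); first exact: filterI.
  move=> x y [Ux _] [_ Uy] /Le xy.
  apply: (mulIg y^-1%g); rewrite mulgV; apply: xy => i j.
  exact: (sub (x, y) (conj Ux Uy) (i, j)).
pose inj j := forall x y, V j x -> V j y -> L (x * y^-1)%g -> x = y.
(* Codes of cubes that fail [inj], and numbers that are not codes, give the empty set. *)
pose U m : set G := if unpickle m is Some j then [set g | inj j /\ V j g] else set0.
have U_open m : open (U m).
  rewrite /U; case: unpickle => [j|]; last exact: open0.
  have [ij|nij] := pselect (inj j).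
    by rewrite (_ : [set _ | _] = V j) //; apply/seteqP; split=> g // [].
  by rewrite (_ : [set _ | _] = set0); [exact: open0|apply/seteqP; split=> g // []].
have U_inj m x y : U m x -> U m y -> L (x * y^-1)%g -> x = y.
  by rewrite /U; case: unpickle => // j [ij Vx] [_ Vy]; apply: ij.
have U_cover g : exists m, U m g.
  have [W nW Winj] := loc_inj g; have [j Vg VW] := V_basis nW.
  exists (pickle j); rewrite /U pickleK; split=> // x y Vx Vy.
  by apply: Winj; apply: VW.
pose LU m := \bigcup_(l in L) [set (l * a)%g | a in U m].
have mopen (A : set G) : open A -> measurable (A : set (borel G)).
  exact: sub_sigma_algebra.
exists (\bigcup_m (U m `\` \bigcup_(k in `I_m) LU k)); split.
- apply: (@bigcup_measurable _ (borel G)) => m _.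
  apply: (@measurableD _ (borel G)); first exact: mopen.
  apply: mopen; apply: bigcup_open => k _; apply: bigcup_open => l _.
  exact: open_mulg.
- move=> g.
  pose P m := `[< exists2 l, L l & U m (l * g)%g >].
  have exP : exists m, P m.
    by have [m Um] := U_cover g; exists m; apply/asboolP; exists 1%g;
      [exact: sL.1|rewrite mul1g].
  case: (ex_minnP exP) => m /asboolP[l Ll Um] mmin.
  exists l => //; exists m => //; split=> // -[k /= km [l' Ll' [a Ua al]]].
  have : P k.
    apply/asboolP; exists (l'^-1 * l)%g.
      by apply: (subgroupM sL) => //; apply: (subgroupV sL).
    by rewrite -mulgA -al mulKg.
  by move/mmin; rewrite leqNgt km.
- have key m k x y : U m x -> (U k `\` \bigcup_(k0 in `I_k) LU k0) y ->
      L (x * y^-1)%g -> (k <= m)%N.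
    move=> Ux [Uy nU] Lxy; rewrite leqNgt; apply/negP => mk; apply: nU.
    exists m => //; exists (x * y^-1)^-1%g; first exact: subgroupV.
    by exists x => //; rewrite invgM invgK mulgVK.
  move=> x y [m _ Umx] [k _ Uky] Lxy.
  have Lyx : L (y * x^-1)%g by rewrite -[(_ * _)%g]invgK invgM invgK; apply: subgroupV.
  have mk : m = k.
    apply/eqP; rewrite eqn_leq (key _ _ _ _ Uky.1 Umx) //.
    by rewrite (key _ _ _ _ Umx.1 Uky).
  by apply: (U_inj m) => //; [case: Umx|rewrite mk; case: Uky].
Qed.

End Existence.
End FundamentalSets.

(** * Gaussian integers *)

Lemma int_parity (x : int) : exists k : int, x = 2 * k \/ x = 2 * k + 1.
Proof.
exists (x %/ 2)%Z; have := divz_eq x 2.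
have : ((x %% 2)%Z == 0) || ((x %% 2)%Z == 1) by lia.
by case/orP => /eqP ->; [left|right]; lia.
Qed.

Section GaussianIntegers.
Variable R : realType.
Local Notation C := R[i].
Local Notation O := (@gaussian_int R).
Local Notation I := ('i%C : C).
Implicit Types z w : C.

Lemma gauss0 : O 0. Proof. by split; apply: int_num0. Qed.
Lemma gauss1 : O 1. Proof. by split; [apply: int_num1|apply: int_num0]. Qed.
Lemma gaussI : O I. Proof. by split; [apply: int_num0|apply: int_num1]. Qed.

Lemma gaussD z w : O z -> O w -> O (z + w).
Proof. by case: z w => [a b] [c d] [/= ? ?] [/= ? ?]; split=> /=; apply: rpredD. Qed.

Lemma gaussN z : O z -> O (- z).
Proof. by case: z => [a b] [/= ? ?]; split=> /=; rewrite rpredN. Qed.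

Lemma gaussB z w : O z -> O w -> O (z - w).
Proof. by move=> Oz Ow; apply: gaussD => //; apply: gaussN. Qed.

Lemma gaussM z w : O z -> O w -> O (z * w).
Proof.
by case: z w => [a b] [c d] [/= ? ?] [/= ? ?]; split=> /=;
  [apply: rpredB|apply: rpredD]; apply: rpredM.
Qed.

Lemma sqrI : I * I = -1 :> C.
Proof. by rewrite -expr2 sqr_i. Qed.

Definition normsq z : R := complex.Re z ^+ 2 + complex.Im z ^+ 2.

Lemma normsqM z w : normsq (z * w) = normsq z * normsq w.
Proof. by case: z w => [a b] [c d]; rewrite /normsq /=; ring. Qed.

Lemma normsq_ge0 z : 0 <= normsq z.
Proof. by rewrite addr_ge0 // sqr_ge0. Qed.

Lemma normsq_eq0 z : (normsq z == 0) = (z == 0).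
Proof.
by rewrite paddr_eq0 ?sqr_ge0 // !sqrf_eq0 eq_complex.
Qed.

Lemma normsq_gauss z : O z -> exists k : nat, normsq z = k%:R.
Proof.
case=> Oz Oz'; suff /natrP[k ->] : normsq z \is a Num.nat by exists k.
by rewrite natrEint normsq_ge0 andbT rpredD // rpredX.
Qed.

Lemma gauss_small z : O z -> normsq z < 1 -> z = 0.
Proof.
move=> /normsq_gauss[[|k] e]; last by rewrite e ltrn1.
by move=> _; apply/eqP; rewrite -normsq_eq0 e.
Qed.

(** The norms of z and w are natural numbers with product one, so z is one of 1, -1, i, -i. As -1 is
    the square of i, the units modulo squares of units are represented by 1 and i. *)
Lemma gauss_unit z w : O z -> O w -> z * w = 1 ->
  exists2 u, O u & z = u ^+ 2 \/ z = I * u ^+ 2.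
Proof.
move=> Oz Ow zw.
have n1 : normsq z = 1.
  have [k ek] := normsq_gauss Oz; have [l el] := normsq_gauss Ow.
  have /eqP : normsq (z * w) = 1 by rewrite zw /normsq /= expr1n expr0n addr0.
  by rewrite normsqM ek el -natrM pnatr_eq1 muln_eq1 => /andP[/eqP -> _].
have II := sqrI.
have [[x xE] [y yE]] : (exists x : int, complex.Re z = x%:~R) /\
    (exists y : int, complex.Im z = y%:~R).
  by case: Oz => /intrP ? /intrP ?.
have : x ^+ 2 + y ^+ 2 = 1.
  by apply/eqP; rewrite -(eqr_int R) rmorphD !rmorphXn /= -xE -yE -n1.
have zE : z = (complex.Re z)%:C%C + I * (complex.Im z)%:C%C.
  by case: (z) => a b; apply/eqP; rewrite eq_complex /=; apply/andP; split; apply/eqP; ring.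
move=> xy; have [y0|y0] := eqVneq y 0.
  have /eqP : x ^+ 2 = 1 by rewrite -xy y0 expr0n addr0.
  rewrite sqrf_eq1 => /orP[] /eqP x1.
    exists 1; [exact: gauss1|left].
    by rewrite zE xE yE x1 y0 expr1n /= mulr0 addr0.
  exists I; [exact: gaussI|left].
  by rewrite zE xE yE x1 y0 /= mulr0 addr0 rmorphN1 expr2 II.
have y1 : y ^+ 2 = 1 /\ x = 0.
  have : 0 < y ^+ 2 by rewrite exprn_even_gt0.
  have : 0 <= x ^+ 2 by rewrite sqr_ge0.
  move=> x0 y1; have x00 : x ^+ 2 = 0 by lia.
  by split; [rewrite -xy x00 add0r|apply/eqP; rewrite -sqrf_eq0 x00].
case: y1 => /eqP + x0; rewrite sqrf_eq1 => /orP[] /eqP y1.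
  exists 1; [exact: gauss1|right].
  by rewrite zE xE yE x0 y1 expr1n /= add0r.
exists I; [exact: gaussI|right].
by rewrite zE xE yE x0 y1 /= add0r rmorphN1 expr2 II.
Qed.

(** Rounding both coordinates to a nearest integer leaves a norm of at most 1/2; this is Euclidean
    division in Z[i]. *)
Lemma gauss_round z : exists2 k, O k & normsq (z - k) < 1.
Proof.
have round (x : R) : exists2 k : int, True & (x - k%:~R) ^+ 2 <= 1 / 4.
  exists (Num.floor (x + 1 / 2)) => //.
  have /andP[] := floor_itv (x + 1 / 2); rewrite intrD.
  by set f := _%:~R => ? ?; nra.
case: z => a b; have [k _ ka] := round a; have [l _ lb] := round b.
exists (k%:~R +i* l%:~R)%C; first by split=> /=; apply: intr_int.
rewrite /normsq /=; lra.
Qed.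

(** A case of the integral closedness of Z[i]. Since (1 + i)^2 = 2 i, the same statement with 1 + i
    in place of 2, applied twice, is enough. *)
Lemma gauss_half z : O (2 * z) -> O (z * z) -> O z.
Proof.
suff key w : O ((1 + I) * w) -> O (w * w) -> O w.
  move=> O2 Oz; have II := sqrI; apply: (key) => //; apply: key.
    by rewrite (_ : _ * _ = I * (2 * z)); [exact: gaussM gaussI _|ring: II].
  rewrite (_ : _ * _ = I * (2 * (z * z))); last by ring: II.
  apply: gaussM; first exact: gaussI.
  by rewrite mulr_natl mulr2n; apply: gaussD.
have II := sqrI.
case=> [/intrP[x ex] /intrP[y ey]] [_ /intrP[m em]].
case: w ex ey em => a b /= ex ey em.
have a2 : a = (x + y)%:~R / 2 by rewrite rmorphD /= -ex -ey; field.
have b2 : b = (y - x)%:~R / 2 by rewrite rmorphB /= -ex -ey; field.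
(* Here x + y = 2 a, y - x = 2 b, and m = 2 a b is the imaginary part of w^2. The two factors have
   the same parity, so both are even. *)
have xym : (y - x) * (y + x) = 2 * m.
  by apply/eqP; rewrite -(eqr_int R) !rmorphM rmorphB rmorphD /= -em -ex -ey; apply/eqP; ring.
have [k xk] : exists k, x + y = 2 * k.
  have [k [kx|kx]] := int_parity x; have [l [ly|ly]] := int_parity y; subst x y.
  - by exists (k + l); ring.
  - by exfalso; lia.
  - by exfalso; lia.
  - by exists (k + l + 1); ring.
split=> /=; apply/intrP.
  by exists k; rewrite a2 xk rmorphM /=; field.
by exists (y - k); rewrite b2 (_ : y - x = 2 * (y - k)) ?rmorphM /=; [field|lia].
Qed.

(* The Z[i]-module of all z with z p, z q, z r, z t in Z[i] is a lattice whose
   nonzero element v of least norm generates it, by Euclidean division; then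
   1 = p t - q r is v^2 times a Gaussian integer. *)
Lemma gauss_proportional (p q r t : C) :
    p * t - q * r = 1 -> O (p * p) -> O (p * q) -> O (p * r) -> O (p * t) ->
    O (q * q) -> O (q * r) -> O (q * t) -> O (r * r) -> O (r * t) -> O (t * t) ->
  exists v u, [/\ O u, v ^+ 2 = u ^+ 2 \/ v ^+ 2 = I * u ^+ 2
    & exists p' q' r' t', [/\ O p', O q', O r' & O t'] /\
        [/\ p = p' * v, q = q' * v, r = r' * v & t = t' * v]].
Proof.
move=> det1 pp pq pr pt qq qr qt rr rt tt.
pose L z := [/\ O (z * p), O (z * q), O (z * r) & O (z * t)].
have Lp : L p by split.
have Lq : L q by split=> //; rewrite mulrC.
have Lr : L r by split=> //; rewrite mulrC.
have Lt : L t by split=> //; rewrite mulrC.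
(* Multiply z w by p t - q r = 1 and distribute one factor of each product to z and the other to
   w. *)
have LM z w : L z -> L w -> O (z * w).
  move=> [zp zq _ _] [_ _ wr wt].
  have -> : z * w = (z * p) * (w * t) - (z * q) * (w * r).
    by rewrite -[LHS]mulr1 -det1; ring.
  by apply: gaussB; apply: gaussM.
have LB z w k : L z -> L w -> O k -> L (z - k * w).
  move=> [zp zq zr zt] [wp wq wr wt] Ok.
  by split; rewrite mulrBl -mulrA; apply: gaussB => //; apply: gaussM.
have [z0 [Lz0 z00]] : exists z0, L z0 /\ z0 != 0.
  have [p0|p0] := eqVneq p 0; last by exists p.
  exists q; split=> //; apply/eqP => q0.
  by move: det1; rewrite p0 q0 !mul0r subrr => /eqP; rewrite eq_sym oner_eq0.
(* The norm of v^2 is minimised rather than that of v, because [LM] makes v^2, and not v, a Gaussian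
   integer. *)
pose P k := `[< exists v, [/\ L v, v != 0 & normsq (v * v) = k%:R] >].
have exP : exists k, P k.
  have [k ek] := normsq_gauss (LM _ _ Lz0 Lz0).
  by exists k; apply/asboolP; exists z0.
case: (ex_minnP exP) => m /asboolP[v [Lv v0 nv]] vmin.
have gen z : L z -> exists2 k, O k & z = k * v.
  move=> Lz; have [k Ok small] := gauss_round (z / v).
  exists k => //; apply/eqP; rewrite -subr_eq0; apply: contraT => zk0.
  have Lzk := LB _ _ _ Lz Lv Ok.
  have [l el] := normsq_gauss (LM _ _ Lzk Lzk).
  have /vmin : P l by apply/asboolP; exists (z - k * v).
  rewrite leqNgt -(ltr_nat R) -nv -el.
  have -> : z - k * v = (z / v - k) * v by field.
  rewrite !normsqM => /negP[]; rewrite mulrACA.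
  have nv0 : 0 < normsq v by rewrite lt_neqAle eq_sym normsq_eq0 v0 normsq_ge0.
  rewrite -[ltRHS]mul1r ltr_pM2r ?mulr_gt0 //.
  by rewrite -[ltRHS]mulr1 ltr_pM ?normsq_ge0.
have [p' Op' ep] := gen _ Lp; have [q' Oq' eq] := gen _ Lq.
have [r' Or' er] := gen _ Lr; have [t' Ot' et] := gen _ Lt.
have [||u Ou uv] := @gauss_unit (v * v) (p' * t' - q' * r') (LM _ _ Lv Lv).
- by apply: gaussB; apply: gaussM.
- by rewrite -det1 ep eq er et; ring.
- exists v, u; split=> //.
  by exists p', q', r', t'.
Qed.

End GaussianIntegers.

(** * The entries of the adjoint matrix *)

Lemma ord2P (P : 'I_2 -> Prop) : P 0 -> P 1 -> forall i, P i.
Proof.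
move=> P0 P1 i.
suff [->|->] : i = 0 \/ i = 1 by [].
by case: i => [[|[|//]] ?]; [left|right]; apply: val_inj.
Qed.

Lemma ord3P (P : 'I_3 -> Prop) : P 0 -> P 1 -> P 2 -> forall i, P i.
Proof.
move=> P0 P1 P2 i.
suff [->|[->|->]] : i = 0 \/ i = 1 \/ i = 2 by [].
by case: i => [[|[|[|//]]] ?]; [left|right; left|right; right]; apply: val_inj.
Qed.

Section TwoByTwo.
Variable K : numFieldType.
Implicit Types A B : 'M[K]_2.

Lemma mx2P A B : A 0 0 = B 0 0 -> A 0 1 = B 0 1 -> A 1 0 = B 1 0 ->
  A 1 1 = B 1 1 -> A = B.
Proof.
by move=> e00 e01 e10 e11; apply/matrixP; apply: ord2P; apply: ord2P.
Qed.

Lemma sum2 (V : nmodType) (F : 'I_2 -> V) : \sum_i F i = F 0 + F 1.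
Proof.
rewrite !big_ord_recr big_ord0 /= add0r.
by congr (F _ + F _); apply: val_inj.
Qed.

Lemma mulmx2E A B i j : (A *m B) i j = A i 0 * B 0 j + A i 1 * B 1 j.
Proof. by rewrite mxE sum2. Qed.

Lemma det2E A : \det A = A 0 0 * A 1 1 - A 0 1 * A 1 0.
Proof.
rewrite (expand_det_row _ 0) sum2 /cofactor !det_mx11 !mxE /=.
have -> : lift (0 : 'I_2) (0 : 'I_1) = 1 by apply: val_inj.
have -> : lift (1 : 'I_2) (0 : 'I_1) = 0 by apply: val_inj.
by rewrite expr0 expr1 mul1r mulN1r mulrN.
Qed.

Lemma SL2_det (g : SL K 2) : g 0 0 * g 1 1 - g 0 1 * g 1 0 = 1.
Proof. by rewrite -det2E (eqP (SL_det g)). Qed.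

Definition mat2 (a b c d : K) : 'M[K]_2 :=
  \matrix_(i, j) if i == 0 then (if j == 0 then a else b)
                 else (if j == 0 then c else d).

Lemma mat2E a b c d : (mat2 a b c d 0 0 = a) * (mat2 a b c d 0 1 = b) *
  (mat2 a b c d 1 0 = c) * (mat2 a b c d 1 1 = d).
Proof. by rewrite !mxE. Qed.

Lemma invmx_SL2 (g : SL K 2) :
  invmx g = mat2 (g 1 1) (- g 0 1) (- g 1 0) (g 0 0).
Proof.
apply: (row_full_inj (A := SL_mx g)); first by rewrite row_full_unit SL_unitmx.
have g1 := SL2_det g.
rewrite mulmxV ?SL_unitmx //; apply: mx2P; rewrite mulmx2E !mat2E !mxE /= -?g1; ring.
Qed.

Lemma SL2P (g h : SL K 2) : g 0 0 = h 0 0 -> g 0 1 = h 0 1 -> g 1 0 = h 1 0 ->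
  g 1 1 = h 1 1 -> g = h.
Proof. by move=> *; apply: val_inj; apply: mx2P. Qed.

Lemma mulSL2E (g h : SL K 2) i j :
  (g * h : SL K 2)%g i j = g i 0 * h 0 j + g i 1 * h 1 j.
Proof. exact: mulmx2E. Qed.

Lemma invSL2E (g : SL K 2) :
  ((g^-1 : SL K 2)%g 0 0 = g 1 1) * ((g^-1 : SL K 2)%g 0 1 = - g 0 1) *
  ((g^-1 : SL K 2)%g 1 0 = - g 1 0) * ((g^-1 : SL K 2)%g 1 1 = g 0 0).
Proof. by rewrite /= !invmx_SL2 !mat2E. Qed.

Lemma oneSL2E :
  ((1 : SL K 2)%g 0 0 = 1) * ((1 : SL K 2)%g 0 1 = 0) *
  ((1 : SL K 2)%g 1 0 = 0) * ((1 : SL K 2)%g 1 1 = 1).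
Proof. by rewrite /= !mxE. Qed.

Fact SL2_of_det (a b c d : K) : a * d - b * c = 1 -> \det (mat2 a b c d) == 1.
Proof. by move=> e; rewrite det2E !mat2E e. Qed.

Definition SL2_of (a b c d : K) (e : a * d - b * c = 1) : SL K 2 :=
  MkSL (SL2_of_det e).

Lemma SL2_ofE a b c d (e : a * d - b * c = 1) :
  (SL2_of e 0 0 = a) * (SL2_of e 0 1 = b) * (SL2_of e 1 0 = c) * (SL2_of e 1 1 = d).
Proof. by rewrite !mat2E. Qed.

End TwoByTwo.

(** * The matrix c(g) in terms of the entries of g *)

Section Cmx.
Variable R : realType.
Local Notation C := R[i].
Local Notation O := (@gaussian_int R).
Local Notation I := ('i%C : C).

Lemma I_neq0 : I != 0.
Proof. by rewrite eq_complex /= oner_eq0 andbF. Qed.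

(** Coefficients along X_1, X_2 and Y, correct when X has trace zero. *)
Definition sl2_coord (X : 'M[C]_2) (j : 'I_3) : C :=
  nth 0 [:: (X 0 1 + X 1 0) / 2; (X 0 1 - X 1 0) / (2 * I); X 0 0] j.

Lemma sum3 (V : nmodType) (F : 'I_3 -> V) : \sum_i F i = F 0 + F 1 + F 2.
Proof.
rewrite !big_ord_recr big_ord0 /= add0r.
by congr (F _ + F _ + F _); apply: val_inj.
Qed.

Lemma sl2_coordK (X : 'M[C]_2) : X 1 1 = - X 0 0 ->
  X = \sum_j sl2_coord X j *: (sl2_basis R)`_j.
Proof.
move=> tr0; rewrite sum3 /sl2_coord /=; have I0 := I_neq0.
have e01 (x y z : C) : x = (x + y) / 2 * 1 + (x - y) / (2 * I) * I + z * 0.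
  by field.
have e10 (x y z : C) : y = (x + y) / 2 * 1 + (x - y) / (2 * I) * - I + z * 0.
  by field.
by apply: mx2P; rewrite !mxE /= ?tr0; [ring|exact: e01|exact: e10|ring].
Qed.

Lemma coord_sl2 (X : 'M[C]_2) j : X 1 1 = - X 0 0 ->
  coord (sl2_basis R) j X = sl2_coord X j.
Proof. by move=> tr0; rewrite {1}(sl2_coordK tr0) coord_sum_free // sl2_basis_free. Qed.

(** The matrix c(g) for g with rows (a, b) and (c, d): conjugation written out on X_1, X_2, Y as
    quadratic forms. *)
Definition cmx_entry (a b c d : C) (j k : 'I_3) : C :=
  nth 0 (nth [::] [::
    [:: (a ^+ 2 - b ^+ 2 - c ^+ 2 + d ^+ 2) / 2;
        I * ((a ^+ 2 + b ^+ 2 - c ^+ 2 - d ^+ 2) / 2); c * d - a * b];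
    [:: (a ^+ 2 - b ^+ 2 + c ^+ 2 - d ^+ 2) / 2 / I;
        (a ^+ 2 + b ^+ 2 + c ^+ 2 + d ^+ 2) / 2; - (a * b + c * d) / I];
    [:: b * d - a * c; - I * (a * c + b * d); a * d + b * c]] j) k.

Lemma cmxE (g : SL C 2) j k : cmx g j k = cmx_entry (g 0 0) (g 0 1) (g 1 0) (g 1 1) j k.
Proof.
have I0 := I_neq0; have ii : ('i : C) = I by [].
rewrite mxE coord_sl2; last first.
  rewrite invmx_SL2 !mulmx2E !mat2E.
  by move: k; apply: ord3P; rewrite !mxE /=; ring.
rewrite /sl2_coord invmx_SL2.
move: k; apply: ord3P; rewrite !mulmx2E !mat2E !mxE /=; move: j; apply: ord3P;
  rewrite /cmx_entry /= ?ii; (try by ring); by field.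
Qed.

Lemma det3E (A : 'M[C]_3) : \det A =
  A 0 0 * (A 1 1 * A 2 2 - A 1 2 * A 2 1) - A 0 1 * (A 1 0 * A 2 2 - A 1 2 * A 2 0)
  + A 0 2 * (A 1 0 * A 2 1 - A 1 1 * A 2 0).
Proof.
rewrite (expand_det_row _ 0) sum3 /cofactor !det2E !mxE /=.
have -> : lift (0 : 'I_3) (0 : 'I_2) = 1 by apply: val_inj.
have -> : lift (0 : 'I_3) (1 : 'I_2) = 2 by apply: val_inj.
have -> : lift (1 : 'I_3) (0 : 'I_2) = 0 by apply: val_inj.
have -> : lift (1 : 'I_3) (1 : 'I_2) = 2 by apply: val_inj.
have -> : lift (2 : 'I_3) (0 : 'I_2) = 0 by apply: val_inj.
have -> : lift (2 : 'I_3) (1 : 'I_2) = 1 by apply: val_inj.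
by ring.
Qed.

(** As identities between polynomials in a, b, c, d, the matrix times its transpose is (ad - bc)^2
    times the identity, and its determinant is (ad - bc)^3. *)
Lemma cmx_SO3 (g : SL C 2) : SO3 (cmx g).
Proof.
have I0 := I_neq0; have II := @sqrI R; have H := SL2_det g.
split.
- apply/matrixP => j k; rewrite [LHS]mxE sum3 ![_^T _ _]mxE [RHS]mxE !cmxE.
  move: (g 0 0) (g 0 1) (g 1 0) (g 1 1) H => a b c d e.
  have VI : I^-1 = - I by apply: (mulfI I0); rewrite mulfV // mulrN II opprK.
  move: j k; apply: ord3P; apply: ord3P; rewrite /cmx_entry /= ?VI;
    first [by field: II |
           by transitivity ((a * d - b * c) ^+ 2); [field: II|rewrite e expr1n]].
- rewrite det3E !cmxE /cmx_entry /=.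
  move: (g 0 0) (g 0 1) (g 1 0) (g 1 1) H => a b c d e.
  transitivity ((a * d - b * c) ^+ 3); first by field.
  by rewrite e expr1n.
Qed.

End Cmx.

(** * Integrality of c(g) as integrality of pairwise products *)

Ltac gauss := repeat (first [assumption | exact: gauss1 | exact: gaussI
  | exact: gauss0 | apply: gaussD | apply: gaussN | apply: gaussM]).

Section CinvGamma.
Variable R : realType.
Local Notation C := R[i].
Local Notation O := (@gaussian_int R).
Local Notation I := ('i%C : C).

Lemma gauss2 : O 2. Proof. by rewrite -[2]/(1 + 1); gauss. Qed.

Lemma gauss_eq (z w : C) : w = z -> O z -> O w. Proof. by move->. Qed.

Lemma cinv_Gamma_cmx (g : SL C 2) : cinv_Gamma R g <->
  forall j k, O (cmx_entry (g 0 0) (g 0 1) (g 1 0) (g 1 1) j k).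
Proof.
split=> [[_ H] j k|H]; first by rewrite -cmxE; apply: H.
by split; [exact: cmx_SO3|move=> j k; rewrite cmxE].
Qed.

Section Coordinates.
Variables a b c d : C.
Hypothesis det1 : a * d - b * c = 1.

(** These are the entries of h^-1 g h, computed in [latt_conjE], for g with rows (a, b) and (c,
    d). *)
Let p := a + b.
Let q := (1 + I) * b.
Let r := (1 - I) / 2 * (c + d - a - b).
Let t := d - b.

(** The four squares are Z[i]-combinations of the entries of c(g). For a mixed product x y this is
    shown only for 2 x y, but (x y)^2 is a product of two squares, so [gauss_half] applies. *)
Lemma pqrt_products : (forall j k, O (cmx_entry a b c d j k)) ->
  [/\ O (p * p), O (p * q), O (p * r), O (p * t) & [/\ O (q * q), O (q * r),
      O (q * t), O (r * r) & O (r * t) /\ O (t * t)]].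
Proof.
move=> H; have II := @sqrI R; have O1 := @gauss1 R; have OI := @gaussI R.
have I0 := @I_neq0 R; have O2 := gauss2.
have unI z : O (I * z) -> O z.
  by move=> Oz; apply: (gauss_eq (z := - (I * (I * z)))); [ring: II|gauss].
have VI : I^-1 = - I by apply: (mulfI I0); rewrite mulfV // mulrN II opprK.
(* Each [e] below is an entry of c(g) up to a unit of Z[i]. Keeping it opaque stops [gauss] from
   breaking it into pieces that need not be integral. *)
have [e11 E11 O11] : exists2 e, e = (a ^+ 2 - b ^+ 2 - c ^+ 2 + d ^+ 2) / 2 & O e.
  by eexists; [reflexivity|exact: (H 0 0)].
have [e12 E12 O12] : exists2 e, e = (a ^+ 2 + b ^+ 2 - c ^+ 2 - d ^+ 2) / 2 & O e.
  by eexists; [reflexivity|apply: unI; exact: (H 0 1)].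
have [e13 E13 O13] : exists2 e, e = c * d - a * b & O e.
  by eexists; [reflexivity|exact: (H 0 2)].
have [e21 E21 O21] : exists2 e, e = (a ^+ 2 - b ^+ 2 + c ^+ 2 - d ^+ 2) / 2 & O e.
  eexists; [reflexivity|apply: (gauss_eq (z := I * cmx_entry a b c d 1 0))].
    by rewrite /cmx_entry /= VI; field: II.
  by apply: gaussM.
have [e22 E22 O22] : exists2 e, e = (a ^+ 2 + b ^+ 2 + c ^+ 2 + d ^+ 2) / 2 & O e.
  by eexists; [reflexivity|exact: (H 1 1)].
have [e23 E23 O23] : exists2 e, e = a * b + c * d & O e.
  eexists; [reflexivity|apply: (gauss_eq (z := - (I * cmx_entry a b c d 1 2)))].
    by rewrite /cmx_entry /= VI; ring: II.
  by apply: gaussN; apply: gaussM.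
have [e31 E31 O31] : exists2 e, e = b * d - a * c & O e.
  by eexists; [reflexivity|exact: (H 2 0)].
have [e32 E32 O32] : exists2 e, e = a * c + b * d & O e.
  eexists; [reflexivity|apply: (gauss_eq (z := I * cmx_entry a b c d 2 1))].
    by rewrite /cmx_entry /=; ring: II.
  by apply: gaussM.
have [e33 E33 O33] : exists2 e, e = a * d + b * c & O e.
  by eexists; [reflexivity|exact: (H 2 2)].
have det1' : a * d = 1 + b * c by rewrite -det1; ring.
have pp : O (p * p).
  apply: (gauss_eq (z := e12 + e22 + (e23 - e13))); last by gauss.
  by rewrite E12 E22 E23 E13 /p; field.
have qq : O (q * q).
  apply: (gauss_eq (z := I * ((e12 + e22) - (e11 + e21)))); last by gauss.
  by rewrite E12 E22 E11 E21 /q; field: II.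
have rr : O (r * r).
  apply: (gauss_eq (z := - I * (e22 + e23 - e32 - e33))); last by gauss.
  by rewrite E22 E23 E32 E33 /r; field: II.
have tt : O (t * t).
  apply: (gauss_eq (z := e22 - e21 - (e31 + e32))); last by gauss.
  by rewrite E22 E21 E31 E32 /t; field.
have sq x y : O (x * x) -> O (y * y) -> O (2 * (x * y)) -> O (x * y).
  move=> Ox Oy /gauss_half; apply.
  by apply: (gauss_eq (z := (x * x) * (y * y))); [ring|gauss].
split=> //; last split=> //; last split=> //.
- apply: sq => //.
  apply: (gauss_eq (z := (1 + I) * (e23 - e13 + ((e12 + e22) - (e11 + e21))))); last by gauss.
  by rewrite E12 E22 E11 E21 E13 E23 /p /q; field.
- apply: sq => //.
  apply: (gauss_eq (z := (1 - I) * (e32 + e33 - p * p))); last by gauss.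
  by rewrite E32 E33 /p /r; field.
- apply: sq => //.
  apply: (gauss_eq (z := e33 + 1 - (e23 - e13) + (e31 + e32)
    - ((e12 + e22) - (e11 + e21)))); last by gauss.
  by rewrite E12 E22 E11 E21 E13 E23 E31 E32 E33 /p /t; field: det1'.
- apply: sq => //.
  apply: (gauss_eq (z := e33 - 1 + (e31 + e32) - (e23 - e13)
    - ((e12 + e22) - (e11 + e21)))); last by gauss.
  by rewrite E12 E22 E11 E21 E13 E23 E31 E32 E33 /q /r; field: det1' II.
- apply: sq => //.
  apply: (gauss_eq (z := (1 + I) * (e31 + e32 - ((e12 + e22) - (e11 + e21))))); last by gauss.
  by rewrite E12 E22 E11 E21 E31 E32 /q /t; field.
- apply: sq => //.
  apply: (gauss_eq (z := (1 - I) * (e23 + (e22 - e21) - e33 - (e31 + e32)))); last by gauss.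
  by rewrite E22 E21 E23 E31 E32 E33 /r /t; field.
Qed.

(** Solving for a, b, c, d introduces the denominator 1 + i through b = q / (1 + i). The entries of
    c(g) involve b only in ways that cancel it, namely through 2 b^2, 2 b p and 2 b t, where 2 / (1
    + i) = 1 - i. *)
Lemma pqrt_cmx : [/\ O (p * p), O (p * q), O (p * r), O (p * t) &
    [/\ O (q * q), O (q * r), O (q * t), O (r * r) & O (r * t) /\ O (t * t)]] ->
  forall j k, O (cmx_entry a b c d j k).
Proof.
move=> [pp pq pr pt [qq qr qt rr [rt tt]]].
have II := @sqrI R; have O1 := @gauss1 R; have OI := @gaussI R.
have I0 := @I_neq0 R.
have VI : I^-1 = - I by apply: (mulfI I0); rewrite mulfV // mulrN II opprK.
have det1' : a * d = 1 + b * c by rewrite -det1; ring.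
have [bb Ebb Obb] : exists2 e, e = 2 * b ^+ 2 & O e.
  exists (- I * (q * q)); last by gauss.
  by rewrite /q; ring: II.
have [bp Ebp Obp] : exists2 e, e = 2 * b * p & O e.
  by exists ((1 - I) * (p * q)); [rewrite /p /q; ring: II|gauss].
have [bt Ebt Obt] : exists2 e, e = 2 * b * t & O e.
  by exists ((1 - I) * (q * t)); [rewrite /q /t; ring: II|gauss].
have O33 : O (a * d + b * c).
  apply: (gauss_eq (z := 1 + 2 * (q * r) + bp - bt - bb)).
    by rewrite Ebp Ebt Ebb /p /q /r /t; field: II det1'.
  by have O2 := gauss2; gauss.
have O23 : O (a * b + c * d).
  apply: (gauss_eq (z := bp - bb + (1 + I) * (r * t) + p * t - t * t - bt + q * r)).
    by rewrite Ebp Ebt Ebb /p /q /r /t; field: II.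
  by gauss.
have O13 : O (c * d - a * b).
  apply: (gauss_eq (z := (a * b + c * d) - bp + bb)); last by gauss.
  by rewrite Ebp Ebb /p; ring.
have O32 : O (a * c + b * d).
  apply: (gauss_eq (z := (1 + I) * (p * r) + p * p - p * t - bp - q * r + bt + bb)).
    by rewrite Ebp Ebt Ebb /p /q /r /t; field: II.
  by gauss.
have O31 : O (b * d - a * c).
  apply: (gauss_eq (z := - ((1 + I) * (p * r) + p * p - p * t - bp - q * r))).
    by rewrite Ebp /p /q /r /t; field: II.
  by gauss.
have O22 : O ((a ^+ 2 + b ^+ 2 + c ^+ 2 + d ^+ 2) / 2).
  apply: (gauss_eq (z := I * (r * r) - (a * b + c * d) + (a * c + b * d) + (a * d + b * c))).
    by rewrite /r; field: II.
  by gauss.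
have O12 : O ((a ^+ 2 + b ^+ 2 - c ^+ 2 - d ^+ 2) / 2).
  apply: (gauss_eq (z := p * p - bp + bb - (a ^+ 2 + b ^+ 2 + c ^+ 2 + d ^+ 2) / 2)).
    by rewrite Ebp Ebb /p; field.
  by gauss.
have O21 : O ((a ^+ 2 - b ^+ 2 + c ^+ 2 - d ^+ 2) / 2).
  apply: (gauss_eq (z := (a ^+ 2 + b ^+ 2 + c ^+ 2 + d ^+ 2) / 2 - (t * t + bt + bb))).
    by rewrite Ebt Ebb /t; field.
  by gauss.
have O11 : O ((a ^+ 2 - b ^+ 2 - c ^+ 2 + d ^+ 2) / 2).
  apply: (gauss_eq (z := p * p - bp - (a ^+ 2 - b ^+ 2 + c ^+ 2 - d ^+ 2) / 2)).
    by rewrite Ebp /p; field.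
  by gauss.
by apply: ord3P; apply: ord3P; rewrite /cmx_entry /= ?VI; gauss.
Qed.

End Coordinates.
End CinvGamma.

(** * Comparison with SL_2(Z[i]) and SL_2(Z) *)

Section Commensurability.
Variable R : realType.
Local Notation C := R[i].
Local Notation O := (@gaussian_int R).
Local Notation I := ('i%C : C).
Implicit Types g m : SL C 2.

Definition zeta : C := ((Num.sqrt 2)^-1 +i* (Num.sqrt 2)^-1)%C.

Lemma sqrt2_sqr : Num.sqrt 2 * Num.sqrt 2 = 2 :> R.
Proof. by rewrite -expr2 sqr_sqrtr. Qed.

Lemma sqrt2_neq0 : Num.sqrt 2 != 0 :> R.
Proof. by rewrite sqrtr_eq0 -ltNge. Qed.

Lemma zeta_sqr : zeta * zeta = I.
Proof.
have s2 := sqrt2_sqr; have s0 := sqrt2_neq0.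
apply/eqP; rewrite eq_complex /=; apply/andP; split; apply/eqP; first by ring.
by rewrite -invfM s2; field.
Qed.

Lemma zeta_notin : ~ O zeta.
Proof.
case=> /= /intrP[x ex] _.
have : x * x * 2 = 1.
  apply/eqP; rewrite -(eqr_int R) !rmorphM /= -ex -invfM sqrt2_sqr.
  by rewrite mulVf ?pnatr_eq0.
by lia.
Qed.

Definition zeta_gauss : set C := [set z | exists2 y, O y & z = zeta * y].
Local Notation zO := zeta_gauss.

Lemma zeta_gaussD z w : zO z -> zO w -> zO (z + w).
Proof. by move=> [x Ox ->] [y Oy ->]; exists (x + y); [gauss|rewrite mulrDr]. Qed.

Lemma zeta_gaussN z : zO z -> zO (- z).
Proof. by move=> [x Ox ->]; exists (- x); [gauss|rewrite mulrN]. Qed.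

Lemma gauss_zetaM z w : O z -> zO w -> zO (z * w).
Proof. by move=> Oz [y Oy ->]; exists (z * y); [gauss|rewrite mulrCA]. Qed.

Lemma zeta_zetaM z w : zO z -> zO w -> O (z * w).
Proof.
move=> [x Ox ->] [y Oy ->]; rewrite mulrACA zeta_sqr.
by have OI := gaussI R; gauss.
Qed.

Definition SL2_zeta : set (SL C 2) := [set m | forall i j, zO (m i j)].

(** SL_2(Z[i]) together with its coset of diag(zeta, zeta^-1); [cinv_GammaP] identifies it with the
    conjugate h^-1 c^-1(Gamma) h. *)
Definition SL2_ext : set (SL C 2) := SL2_gauss R `|` SL2_zeta.

Lemma forall22 (P : C -> Prop) m : (forall i j, P (m i j)) <->
  [/\ P (m 0 0), P (m 0 1), P (m 1 0) & P (m 1 1)].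
Proof.
split=> [H|[? ? ? ?]]; first by split; apply: H.
by apply: ord2P; apply: ord2P.
Qed.

Lemma forall22V (P : C -> Prop) m : (forall z, P z -> P (- z)) ->
  (forall i j, P (m i j)) -> forall i j, P ((m^-1)%g i j).
Proof.
by move=> PN H; rewrite forall22 !invSL2E; split=> //; apply: PN.
Qed.

Lemma subgroup_SL2_gauss : subgroup (SL2_gauss R).
Proof.
split; first by apply/(forall22 O 1%g); rewrite !oneSL2E; split; gauss.
move=> x y Ox /(forall22V (@gaussN R)) Oy i j.
by rewrite mulSL2E; apply: gaussD; apply: gaussM.
Qed.

Lemma subgroup_SL2_ext : subgroup SL2_ext.
Proof.
split; first by left; apply: subgroup_SL2_gauss.1.
move=> x y [Ox|Ox] [Oy|Oy].
- by left; apply: subgroup_SL2_gauss.2.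
- right=> i j; have {}Oy := forall22V zeta_gaussN Oy.
  by rewrite mulSL2E; apply: zeta_gaussD; apply: gauss_zetaM.
- right=> i j; have {}Oy := forall22V (@gaussN R) Oy.
  by rewrite mulSL2E ![x _ _ * _]mulrC; apply: zeta_gaussD; apply: gauss_zetaM.
- left=> i j; have {}Oy := forall22V zeta_gaussN Oy.
  by rewrite mulSL2E; apply: gaussD; apply: zeta_zetaM.
Qed.

Lemma SL2_ext_products m : SL2_ext m -> forall i j k l, O (m i j * m k l).
Proof.
by move=> [H|H] i j k l; [apply: gaussM|apply: zeta_zetaM].
Qed.

Lemma sqrtC_1I : sqrtC (1 + I) != 0.
Proof.
rewrite sqrtC_eq0; apply/eqP => /(congr1 (@complex.Re R)) /=.
by move/eqP; rewrite addr0 oner_eq0.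
Qed.

Fact latt_det : (sqrtC (1 + I))^-1 * (sqrtC (1 + I)) - 0 * (sqrtC (1 + I))^-1 = 1.
Proof. by rewrite mul0r subr0 mulVf // sqrtC_1I. Qed.

(* A scalar multiple of the matrix with columns (1,1), (0,1+i), a basis of the
   lattice {(x,y) in Z[i]^2 | x = y mod 1+i}. *)
Definition latt : SL C 2 := SL2_of latt_det.

Definition latt_conj g : SL C 2 := (latt^-1 * g * latt)%g.

Lemma latt_conjE g : (latt_conj g 0 0 = g 0 0 + g 0 1) *
  (latt_conj g 0 1 = (1 + I) * g 0 1) *
  (latt_conj g 1 0 = (1 - I) / 2 * (g 1 0 + g 1 1 - g 0 0 - g 0 1)) *
  (latt_conj g 1 1 = g 1 1 - g 0 1).
Proof.
have II := @sqrI R; have w0 := sqrtC_1I.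
rewrite /latt_conj !mulSL2E !invSL2E !SL2_ofE.
have ww : sqrtC (1 + I) * sqrtC (1 + I) = 1 + I by rewrite -expr2 sqrtCK.
have wV : (sqrtC (1 + I))^-1 * (sqrtC (1 + I))^-1 = (1 - I) / 2.
  have key : (1 + I) * ((1 - I) / 2) = 1 by field: II.
  have n1 : 1 + I != 0.
    by apply/eqP => n1; move: key; rewrite n1 mul0r => /eqP; rewrite eq_sym oner_eq0.
  by rewrite -invfM ww -[LHS]mulr1 -[X in _ * X]key mulKf.
(* Everything is expressed through v, the inverse of the chosen square root of 1 + i; it enters only
   through v^2 = (1 - i) / 2. *)
have [v vE [wE vv]] : exists2 v, (sqrtC (1 + I))^-1 = v &
    sqrtC (1 + I) = (1 + I) * v /\ v * v = (1 - I) / 2.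
  by exists (sqrtC (1 + I))^-1; rewrite // -{2}ww mulfK.
rewrite vE wE; move: (g 0 0) (g 0 1) (g 1 0) (g 1 1) => a b c d.
do !split.
- by transitivity ((1 + I) * (v * v) * (a + b)); [ring|rewrite vv; field: II].
- by transitivity ((1 + I) ^+ 2 * (v * v) * b); [ring|rewrite vv; field: II].
- by transitivity ((v * v) * (c + d - a - b)); [ring|rewrite vv].
- by transitivity ((1 + I) * (v * v) * (d - b)); [ring|rewrite vv; field: II].
Qed.

Lemma latt_conj_det g : latt_conj g 0 0 * latt_conj g 1 1 - latt_conj g 0 1 * latt_conj g 1 0 = 1.
Proof. exact: SL2_det. Qed.

(** If c(g) is integral, [gauss_proportional] makes the entries of h^-1 g h Gaussian multiples of
    one v with v^2 = u^2 or v^2 = i u^2, so v is u or zeta u up to sign. Conversely, pairwise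
    products of entries are integral in both classes since zeta^2 = i. *)
Lemma cinv_GammaP g : cinv_Gamma R g <-> SL2_ext (latt_conj g).
Proof.
rewrite cinv_Gamma_cmx; split=> [/(pqrt_products (SL2_det g))|H].
  rewrite -!(latt_conjE g) => -[pp pq pr pt [qq qr qt rr [rt tt]]].
  have [v [u [Ou v2 [p [q [r [t [[Op Oq Or Ot] [ep eq er et]]]]]]]]] :=
    gauss_proportional (latt_conj_det g) pp pq pr pt qq qr qt rr rt tt.
  case: v2 => v2.
    left; apply/forall22; rewrite ep eq er et.
    have Ov : O v by move/eqP: v2; rewrite eqf_sqr => /orP[] /eqP ->; gauss.
    by split; gauss.
  right; apply/forall22; rewrite ep eq er et.
  have zv : zO v.
    have : v ^+ 2 = (zeta * u) ^+ 2 by rewrite v2 -zeta_sqr -expr2 exprMn.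
    move/eqP; rewrite eqf_sqr => /orP[] /eqP ->; first by exists u.
    by apply: zeta_gaussN; exists u.
  by split; apply: gauss_zetaM.
have P := SL2_ext_products H.
apply: (pqrt_cmx (SL2_det g)); rewrite -!(latt_conjE g).
by split=> //; split=> //; split.
Qed.

Lemma subgroup_conj (L L' : set (SL C 2)) h :
  (forall x, L' x <-> L (h^-1 * x * h)%g) -> subgroup L -> subgroup L'.
Proof.
move=> LL' [L1 LM]; split; first by rewrite LL' mulg1 mulVg.
move=> x y; rewrite !LL' => Lx Ly.
have -> : (h^-1 * (x * y^-1) * h = (h^-1 * x * h) * (h^-1 * y * h)^-1)%g.
  by rewrite !invgM invgK !mulgA mulgK.
exact: LM.
Qed.

Lemma subgroup_cinv_Gamma : subgroup (cinv_Gamma R).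
Proof. exact: subgroup_conj cinv_GammaP subgroup_SL2_ext. Qed.

Lemma gauss_norm_small z : O z -> `|z| < 1 -> z = 0.
Proof.
move=> Oz z1; apply: gauss_small => //; rewrite -ltcR.
have -> : (normsq z)%:C%C = `|z| ^+ 2.
  by rewrite normc_def -rmorphXn /= sqr_sqrtr ?normsq_ge0.
by rewrite expr_lt1.
Qed.

(** This weak integrality serves to prove discreteness. It follows by solving [latt_conjE] for the
    entries of g; for instance b = q / (1 + i) gives 2 b^2 = - i q^2. *)
Lemma cinv_Gamma_half_sqr g : cinv_Gamma R g -> forall i j, O (2 * g i j ^+ 2).
Proof.
move=> /cinv_GammaP /SL2_ext_products P.
have O1 := @gauss1 R; have OI := @gaussI R; have O2 := @gauss2 R.
have II := @sqrI R; have E := latt_conjE g.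
pose p := latt_conj g 0 0; pose q := latt_conj g 0 1.
pose r := latt_conj g 1 0; pose t := latt_conj g 1 1.
have [pp pq pr pt] : [/\ O (p * p), O (p * q), O (p * r) & O (p * t)] by split; apply: P.
have [qq qr qt] : [/\ O (q * q), O (q * r) & O (q * t)] by split; apply: P.
have [rr rt tt] : [/\ O (r * r), O (r * t) & O (t * t)] by split; apply: P.
apply: (forall22 (fun z => O (2 * z ^+ 2)) g).2; split.
- apply: (gauss_eq (z := 2 * (p * p) - 2 * (1 - I) * (p * q) - I * (q * q))); last by gauss.
  by rewrite /p /q !E; ring: II.
- apply: (gauss_eq (z := - (I * (q * q)))); last by gauss.
  by rewrite /q !E; ring: II.
- apply: (gauss_eq (z := 2 * (2 * I * (r * r) + p * p + t * t + 2 * (1 + I) * (p * r)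
     - 2 * (1 + I) * (r * t) - 2 * (p * t))
     - 2 * (1 - I) * ((1 + I) * (q * r) + p * q - q * t) - I * (q * q))); last by gauss.
  by rewrite /p /q /r /t !E; field: II.
- apply: (gauss_eq (z := 2 * (t * t) + 2 * (1 - I) * (q * t) - I * (q * q))); last by gauss.
  by rewrite /t /q !E; ring: II.
Qed.

(** Off the diagonal 2 z^2, and on it 2 z^2 - 2, is a Gaussian integer of absolute value less than
    one, hence zero. On the diagonal this leaves 1 and -1, and -1 is too far from 1. *)
Lemma half_sqr_gauss_discrete : forall m, (forall i j, O (2 * m i j ^+ 2)) ->
  (forall i j, `|(1%g : SL C 2) i j - m i j| < 1 / 8) -> m = 1%g.
Proof.
move=> m Om lm.
have off z : O (2 * z ^+ 2) -> `|0 - z| < 1 / 8 -> z = 0.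
  rewrite sub0r normrN => /gauss_norm_small + z8.
  have z82 : `|z| ^+ 2 < 1 / 64.
    by rewrite (_ : 1 / 64 = (1 / 8) ^+ 2); [rewrite ltrXn2r ?nnegrE|field].
  rewrite normrM normrX normr_nat => /(_ _) /eqP.
  rewrite mulf_eq0 pnatr_eq0 sqrf_eq0 /= => z0; apply/eqP/z0.
  rewrite -ltr_pdivlMl //; apply: lt_trans z82 _; rewrite mulr1 mul1r.
  by rewrite ltf_pV2 ?posrE // ltr_nat.
have diag z : O (2 * z ^+ 2) -> `|1 - z| < 1 / 8 -> z = 1.
  move=> Oz z8.
  have z82 : `|1 - z| ^+ 2 < 1 / 64.
    by rewrite (_ : 1 / 64 = (1 / 8) ^+ 2); [rewrite ltrXn2r ?nnegrE|field].
  have : 2 * z ^+ 2 - 2 = 0.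
    apply: gauss_norm_small; first by have O2 := @gauss2 R; gauss.
    rewrite (_ : _ - 2 = 2 * (1 - z) ^+ 2 - 4 * (1 - z)); last by ring.
    apply: le_lt_trans (ler_normB _ _) _; rewrite normrM normr_nat normrX normrM normr_nat.
    rewrite [ltRHS](_ : 1 = 2 * (1 / 4) + 4 * (1 / 8)); last by field.
    apply: ltrD; rewrite ltr_pM2l //; apply: lt_trans z82 _.
    by rewrite !mul1r ltf_pV2 ?posrE // ltr_nat.
  have -> : 2 * z ^+ 2 - 2 = 2 * ((z - 1) * (z + 1)) by ring.
  move=> /eqP; rewrite !mulf_eq0 pnatr_eq0 /= subr_eq0 addr_eq0 => /orP[/eqP//|/eqP z1].
  move: z8; rewrite z1 opprK -[1 + 1]/(2%:R) normr_nat => /lt_trans.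
  move/(_ 1); rewrite mul1r invf_lt1 ?ltr1n // => /(_ isT).
  by rewrite ltrn1.
apply: SL2P; rewrite !oneSL2E.
- by apply: diag => //; have := lm 0 0; rewrite !oneSL2E.
- by apply: off => //; have := lm 0 1; rewrite !oneSL2E.
- by apply: off => //; have := lm 1 0; rewrite !oneSL2E.
- by apply: diag => //; have := lm 1 1; rewrite !oneSL2E.
Qed.

End Commensurability.

(** * The real points: the theta group and its cosets *)

Section Real.
Variable R : realType.
Local Notation C := R[i].
Local Notation O := (@gaussian_int R).
Local Notation I := ('i%C : C).
Local Notation s := (Num.sqrt 2 : R).

Lemma rat_dense (x e : R) : 0 < e -> exists t : rat, `|x - ratr t| < e.
Proof.
move=> e0; have [|t] := @rat_in_itvoo R (x - e) (x + e).
  by rewrite ltrD2l (lt_trans _ e0) // oppr_lt0.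
rewrite in_itv /= => /andP[t1 t2]; exists t.
by rewrite ltr_norml ltrBDl ltrBlDl; apply/andP; split; lra.
Qed.

Definition rat_complex (t : rat * rat) : C := (ratr t.1 +i* ratr t.2)%C.

Lemma rat_complex_dense (x e : C) : 0 < e -> exists t, `|x - rat_complex t| < e.
Proof.
case: x e => x y [e e']; rewrite ltcE /= => /andP[/eqP -> e0].
have [t te] := rat_dense x (divr_gt0 e0 (ltr0n _ 2)).
have [u ue] := rat_dense y (divr_gt0 e0 (ltr0n _ 2)).
exists (t, u); rewrite normc_def ltcR /= -[ltRHS]gtr0_norm // -sqrtr_sqr.
rewrite ltr_sqrt ?exprn_gt0 //.
have sq (z : R) : `|z| < e / 2 -> z ^+ 2 < (e / 2) ^+ 2.
  by move=> ze; rewrite -real_normK ?num_real // ltrXn2r ?nnegrE ?divr_ge0 // ltW.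
have := sq _ te; have := sq _ ue.
rewrite (_ : (e / 2) ^+ 2 = e ^+ 2 / 4); last by field.
have : 0 < e ^+ 2 by rewrite exprn_gt0.
by lra.
Qed.

Lemma SL_complexE (g : SL R 2) i j : SL_complex g i j = (g i j)%:C%C.
Proof. by rewrite mxE. Qed.

Lemma SL_complex_div (x y : SL R 2) :
  SL_complex (x * y^-1)%g = (SL_complex x * (SL_complex y)^-1)%g.
Proof.
by apply: SL2P; rewrite SL_complexE !mulSL2E !invSL2E !SL_complexE
  ?rmorphD ?rmorphM ?rmorphN.
Qed.

Lemma SL_complex1 : SL_complex (1%g : SL R 2) = 1%g.
Proof. by apply: SL2P; rewrite SL_complexE !oneSL2E ?rmorph1 ?rmorph0. Qed.

Lemma SL_complex_inj : injective (@SL_complex R 2).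
Proof.
move=> x y xy; apply: val_inj; apply/matrixP => i j.
by have := congr1 (fun g : SL C 2 => complex.Re (g i j)) xy; rewrite !SL_complexE.
Qed.

Lemma half_sqr_int_discrete (L : set (SL R 2)) :
  (forall g, L g -> forall i j, O (2 * SL_complex g i j ^+ 2)) ->
  exists2 e : R, 0 < e &
    forall g, L g -> (forall i j, `|(1%g : SL R 2) i j - g i j| < e) -> g = 1%g.
Proof.
move=> LO; exists (1 / 8) => [|g Lg g1]; first by rewrite divr_gt0.
apply: SL_complex_inj; rewrite SL_complex1; apply: half_sqr_gauss_discrete.
  exact: LO.
move=> i j; rewrite -SL_complex1 !SL_complexE -rmorphB.
have -> : 1 / 8 = (1 / 8 : R)%:C%C by rewrite rmorphM /= fmorphV rmorph1 rmorph_nat.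
by rewrite normc_def /= expr0n addr0 sqrtr_sqr ltcR.
Qed.

Lemma gauss_real (x : R) : O x%:C%C <-> x \is a Num.int.
Proof. by split=> [[]//|xZ]; split=> //=; apply: int_num0. Qed.

Lemma cinv_Gamma_intP (g : SL R 2) :
  cinv_Gamma_int R g <-> cinv_Gamma R (SL_complex g).
Proof. by rewrite cinv_Gamma_intE. Qed.

Lemma subgroup_cinv_Gamma_int : subgroup (cinv_Gamma_int R).
Proof.
have [L1 LM] := subgroup_cinv_Gamma R; split.
  by rewrite cinv_Gamma_intP SL_complex1.
by move=> x y; rewrite !cinv_Gamma_intP SL_complex_div; apply: LM.
Qed.

Lemma SL2_intP (g : SL R 2) : SL2_int R g <->
  [/\ g 0 0 \is a Num.int, g 0 1 \is a Num.int, g 1 0 \is a Num.int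
    & g 1 1 \is a Num.int].
Proof.
split=> [H|[? ? ? ?]]; first by split; apply: H.
by apply: ord2P; apply: ord2P.
Qed.

Lemma subgroup_SL2_int : subgroup (SL2_int R).
Proof.
split; first by apply/SL2_intP; rewrite !oneSL2E.
move=> x y /SL2_intP[? ? ? ?] /SL2_intP[? ? ? ?].
by apply/SL2_intP; rewrite !mulSL2E !invSL2E; split;
  apply: rpredD; apply: rpredM; rewrite ?rpredN.
Qed.

Lemma countable_SL2_int : countable (SL2_int R).
Proof.
apply/countable_injP.
exists (fun g : SL R 2 => pickle (Num.floor (g 0 0), Num.floor (g 0 1),
  Num.floor (g 1 0), Num.floor (g 1 1))).
move=> x y /set_mem/SL2_intP[x1 x2 x3 x4] /set_mem/SL2_intP[y1 y2 y3 y4].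
have fl (u v : R) : u \is a Num.int -> v \is a Num.int ->
    Num.floor u = Num.floor v -> u = v.
  by rewrite !intrEfloor => /eqP {2}<- /eqP {2}<- ->.
by move=> /(pcan_inj pickleK)[] *; apply: SL2P; apply: fl.
Qed.

(** In SL_2(F_2), of order six, only the identity and the swap of coordinates have an even entry
    sum, whence the index three. *)
Definition theta : set (SL R 2) := SL2_int R `&`
  [set g | (g 0 0 + g 0 1 + g 1 0 + g 1 1) / 2 \is a Num.int].

Lemma subgroup_theta : subgroup theta.
Proof.
have [S1 SM] := subgroup_SL2_int; split.
  split=> //=; rewrite !oneSL2E (_ : _ / 2 = 1) //; by field.
move=> x y [Sx tx] [Sy ty]; split; first exact: SM.
move: Sx Sy tx ty => /SL2_intP[? ? ? ?] /SL2_intP[? ? ? ?]; rewrite /mkset.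
set sx := _ / 2; set sy := _ / 2 => ? ?.
rewrite !mulSL2E !invSL2E.
(* The entries of x y^-1 sum to (x00 + x10)(y11 - y01) + (x01 + x11)(y00 - y10). Eliminating x01 +
   x11 and y11 in favour of the half sums [sx] and [sy] brings out a factor 2. *)
rewrite (_ : _ / 2 = (x 0 0 + x 1 0) * (sy - y 0 1) + sx * (y 0 0 - y 1 0)
   - (x 0 0 + x 1 0) * y 0 0); last by rewrite /sx /sy; field.
by clearbody sx sy; rewrite ?(rpredB, rpredD, rpredM).
Qed.

(** Evenness is what makes the lower left entry of [latt_conj] integral: it is 1 - i times the half
    sum of the entries minus a + b. *)
Lemma theta_cinv_Gamma_int : theta `<=` cinv_Gamma_int R.
Proof.
move=> g [/SL2_intP[/gauss_real a /gauss_real b /gauss_real c /gauss_real d]].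
move=> /= /gauss_real h; apply/cinv_Gamma_intP/cinv_GammaP; left.
have O1 := gauss1 R; have OI := gaussI R.
apply/(forall22 O); rewrite !latt_conjE !SL_complexE; split; do 1?by gauss.
apply: (gauss_eq (z := (1 - I) * (((g 0 0 + g 0 1 + g 1 0 + g 1 1) / 2)%:C%C
  - (g 0 0)%:C%C - (g 0 1)%:C%C))); last by gauss.
by rewrite rmorphM fmorphV rmorph_nat !rmorphD; field.
Qed.

Lemma zetaE : zeta R = (1 + I) * (s^-1)%:C%C.
Proof.
by apply/eqP; rewrite eq_complex /=; apply/andP; split; apply/eqP; ring.
Qed.

Fact theta_normalizer_det : s^-1 * s^-1 - (- s^-1) * s^-1 = 1.
Proof.
by rewrite mulNr opprK -invfM sqrt2_sqr; field.
Qed.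

(** The rotation by pi/4; its square, the rotation by pi/2, lies in the theta group. *)
Definition theta_normalizer : SL R 2 := SL2_of theta_normalizer_det.

Lemma theta_normalizer_cinv_Gamma_int : cinv_Gamma_int R theta_normalizer.
Proof.
apply/cinv_Gamma_intP/cinv_GammaP; right.
have O1 := gauss1 R; have OI := gaussI R; have II := @sqrI R.
apply/(forall22 (@zeta_gauss R)); rewrite !latt_conjE !SL_complexE !SL2_ofE !rmorphN /=.
split.
- by exists 0; [exact: gauss0|ring].
- by exists (-1); [gauss|rewrite zetaE; ring].
- exists (- I); [gauss|rewrite zetaE]; by move: (s^-1)%:C%C => v; field: II.
- by exists (1 - I); [gauss|rewrite zetaE; ring: II].
Qed.

(** The factor (1 - i) / sqrt 2 is the inverse of zeta. *)
Lemma zeta_gauss_int (z : C) : zeta_gauss z -> O ((1 - I) * (s^-1)%:C%C * z).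
Proof.
have O1 := gauss1 R; have OI := gaussI R; have II := @sqrI R.
move=> [y Oy ->]; apply: (gauss_eq (z := y)) => //.
have s2 : (s^-1)%:C%C * (s^-1)%:C%C * 2 = 1 :> C.
  rewrite -rmorphM /= -invfM sqrt2_sqr -(rmorph_nat (real_complex R)) -rmorphM /=.
  by rewrite mulVf ?rmorph1 // pnatr_eq0.
transitivity ((s^-1)%:C%C * (s^-1)%:C%C * 2 * y); last by rewrite s2 mul1r.
by rewrite zetaE; ring: II.
Qed.

Lemma gauss_real_1I (x : R) : O ((1 - I) * x%:C%C) -> x \is a Num.int.
Proof.
move=> [+ _]; rewrite (_ : complex.Re _ = x) //=; by ring.
Qed.

(** The hypotheses say that h^-1 g h has entries in Z[i]. As a, b, c, d are real, a real multiple of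
    1 - i is integral only if the real factor is; the lower left entry then gives the evenness that
    defines [theta]. *)
Lemma int_entries (a b c d : R) :
    O (a%:C%C + b%:C%C) -> O ((1 + I) * b%:C%C) ->
    O ((1 - I) / 2 * (c%:C%C + d%:C%C - a%:C%C - b%:C%C)) ->
    O (d%:C%C - b%:C%C) ->
  [/\ a \is a Num.int, b \is a Num.int, c \is a Num.int, d \is a Num.int &
      (a + b + c + d) / 2 \is a Num.int].
Proof.
move=> Op Oq Or Ot; have OI := gaussI R; have II := @sqrI R.
have p : a + b \is a Num.int by case: Op.
have q : b \is a Num.int.
  apply: gauss_real_1I; apply: (gauss_eq (z := - I * ((1 + I) * b%:C%C))).
    by ring: II.
  by gauss.
have t : d - b \is a Num.int by case: Ot.
have r : (c + d - a - b) / 2 \is a Num.int.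
  apply: gauss_real_1I; apply: gauss_eq Or.
  by rewrite rmorphM fmorphV rmorph_nat !rmorphB !rmorphD; ring.
have ai : a \is a Num.int by rewrite -(addrK b a) rpredB.
have di : d \is a Num.int by rewrite -(subrK b d) rpredD.
split=> //.
  rewrite (_ : c = (c + d - a - b) / 2 + (c + d - a - b) / 2 + (a + b) - d); last by field.
  by rewrite rpredB // rpredD // rpredD.
rewrite (_ : _ / 2 = (c + d - a - b) / 2 + (a + b)); last by field.
by rewrite rpredD.
Qed.

(** The conclusions are the four entries of g times the rotation by pi/4, and half their sum, for g
    with rows (a, b) and (c, d). *)
Lemma zeta_entries (a b c d : R) :
    zeta_gauss (a%:C%C + b%:C%C) -> zeta_gauss ((1 + I) * b%:C%C) ->
    zeta_gauss ((1 - I) / 2 * (c%:C%C + d%:C%C - a%:C%C - b%:C%C)) ->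
    zeta_gauss (d%:C%C - b%:C%C) ->
  [/\ (a + b) / s \is a Num.int, (b - a) / s \is a Num.int,
      (c + d) / s \is a Num.int, (d - c) / s \is a Num.int &
      (b + d) / s \is a Num.int].
Proof.
have OI := gaussI R; have II := @sqrI R.
move=> /zeta_gauss_int Op /zeta_gauss_int Oq /zeta_gauss_int Or /zeta_gauss_int Ot.
have p : (a + b) / s \is a Num.int.
  apply: gauss_real_1I; apply: gauss_eq Op.
  by rewrite rmorphM rmorphD; ring.
have q : 2 * b / s \is a Num.int.
  apply/gauss_real; apply: gauss_eq Oq.
  by rewrite !rmorphM rmorph_nat; ring: II.
have r : (c + d - a - b) / s \is a Num.int.
  apply/gauss_real; apply: (gauss_eq (z := I * ((1 - I) * (s^-1)%:C%C *
    ((1 - I) / 2 * (c%:C%C + d%:C%C - a%:C%C - b%:C%C))))).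
    by rewrite rmorphM !rmorphB rmorphD /=; move: (s^-1)%:C%C => v; field: II.
  by gauss.
have t : (d - b) / s \is a Num.int.
  apply: gauss_real_1I; apply: gauss_eq Ot.
  by rewrite rmorphM rmorphB; ring.
have cd : (c + d) / s \is a Num.int.
  by rewrite (_ : _ / s = (c + d - a - b) / s + (a + b) / s); [rewrite rpredD|ring].
have bd : (b + d) / s \is a Num.int.
  by rewrite (_ : _ / s = (d - b) / s + 2 * b / s); [rewrite rpredD|ring].
split=> //.
  by rewrite (_ : _ / s = 2 * b / s - (a + b) / s); [rewrite rpredB|ring].
rewrite (_ : _ / s = (b + d) / s + (d - b) / s - (c + d) / s); last by ring.
by rewrite rpredB // rpredD.
Qed.

Lemma cinv_Gamma_int_theta (g : SL R 2) : cinv_Gamma_int R g ->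
  theta g \/ theta (g * theta_normalizer)%g.
Proof.
have s0 := sqrt2_neq0 R.
move=> /cinv_Gamma_intP/cinv_GammaP[/(forall22 O)|/(forall22 (@zeta_gauss R))];
  rewrite !latt_conjE !SL_complexE => -[p q r t].
  by left; have [? ? ? ? ?] := int_entries p q r t; split; [apply/SL2_intP|].
right; have [ab ba cd dc bd] := zeta_entries p q r t; split.
  apply/SL2_intP; rewrite !mulSL2E !SL2_ofE; split.
  - by rewrite (_ : _ + _ = (g 0 0 + g 0 1) / s) //; ring.
  - by rewrite (_ : _ + _ = (g 0 1 - g 0 0) / s) //; ring.
  - by rewrite (_ : _ + _ = (g 1 0 + g 1 1) / s) //; ring.
  - by rewrite (_ : _ + _ = (g 1 1 - g 1 0) / s) //; ring.
rewrite /mkset !mulSL2E !SL2_ofE.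
by rewrite (_ : _ / 2 = (g 0 1 + g 1 1) / s) //; field.
Qed.

Lemma half_odd (n : int) : ((2 * n + 1)%:~R / 2 : R) \isn't a Num.int.
Proof.
apply/negP => /intrP[k ek].
have : 2 * n + 1 = 2 * k.
  apply/eqP; rewrite -(eqr_int R) [X in _ == X]rmorphM /= -ek.
  by apply/eqP; field.
by lia.
Qed.

Lemma theta_normalizer_notin : ~ theta theta_normalizer.
Proof.
move=> [/SL2_intP[+ _ _ _] _]; rewrite !SL2_ofE => /intrP[x ex].
have : x * x * 2 = 1.
  apply/eqP; rewrite -(eqr_int R) !rmorphM /= -ex -invfM sqrt2_sqr.
  by rewrite mulVf ?pnatr_eq0.
by lia.
Qed.

Fact upper_det : (1 : R) * 1 - 1 * 0 = 1. Proof. by ring. Qed.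
Fact lower_det : (1 : R) * 1 - 0 * 1 = 1. Proof. by ring. Qed.

(** The identity and the two elementary unipotent matrices; beyond index 2 the value is the
    identity, so that every index gives an element of SL_2(Z). *)
Definition theta_reps (i : nat) : SL R 2 :=
  nth 1%g [:: 1%g; SL2_of upper_det; SL2_of lower_det] i.

Lemma theta_repsE : (theta_reps 0 = 1%g) * (theta_reps 1 = SL2_of upper_det) *
  (theta_reps 2 = SL2_of lower_det).
Proof. by []. Qed.

Lemma theta_reps_int i : SL2_int R (theta_reps i).
Proof.
case: i => [|[|[|i]]]; rewrite /theta_reps /= ?nth_nil; apply/SL2_intP;
  by rewrite ?SL2_ofE ?oneSL2E.
Qed.

(** For g with rows (a, b) and (c, d), the three quotients have entry sums a + b + c + d, b + d and
    a + c. If the first is odd, one of the other two is even. *)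
Lemma theta_reps_cover (g : SL R 2) : SL2_int R g ->
  exists2 i, (i < 3)%N & theta (g * (theta_reps i)^-1)%g.
Proof.
move=> Sg; have key i : (g * (theta_reps i)^-1)%g \in SL2_int R.
  by apply/mem_set; apply: subgroup_SL2_int.2 => //; apply: theta_reps_int.
have /SL2_intP[/intrP[a ea] /intrP[b eb] /intrP[c ec] /intrP[d ed]] := Sg.
have half (x : R) (k : int) : x = (2 * k)%:~R -> x / 2 \is a Num.int.
  by move=> ->; apply/intrP; exists k; rewrite rmorphM /=; field.
have [k [e1|o1]] := int_parity (a + b + c + d).
  exists 0%N => //; split; first exact: set_mem.
  rewrite /mkset !theta_repsE !mulSL2E !invSL2E !oneSL2E ea eb ec ed.
  by apply: (half _ k); rewrite -e1 !rmorphD /=; ring.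
have [l [e2|o2]] := int_parity (b + d).
  exists 1%N => //; split; first exact: set_mem.
  rewrite /mkset !theta_repsE !mulSL2E !invSL2E !SL2_ofE ea eb ec ed.
  by apply: (half _ l); rewrite -e2 !rmorphD /=; ring.
exists 2%N => //; split; first exact: set_mem.
rewrite /mkset !theta_repsE !mulSL2E !invSL2E !SL2_ofE ea eb ec ed.
apply: (half _ (k - l)); rewrite (_ : 2 * (k - l) = a + c); last by lia.
by rewrite !rmorphD /=; ring.
Qed.

(** The quotient of two distinct representatives has entry sum 1 or 3, which is odd. *)
Lemma theta_reps_inj i j : (i < 3)%N -> (j < 3)%N ->
  theta (theta_reps i * (theta_reps j)^-1)%g -> i = j.
Proof.
have odd (x : R) (n : int) : x = 2 * n%:~R + 1 -> x / 2 \is a Num.int -> False.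
  by move=> -> x2; have := half_odd n; rewrite rmorphD rmorphM /= x2.
move=> i3 j3 [_]; rewrite /mkset !mulSL2E !invSL2E.
case: i j i3 j3 => [|[|[|//]]] [|[|[|//]]] // _ _; rewrite !theta_repsE
  ?SL2_ofE ?oneSL2E => /odd.
- by case/(_ 0); ring.
- by case/(_ 0); ring.
- by case/(_ 1); ring.
- by case/(_ 0); ring.
- by case/(_ 1); ring.
- by case/(_ 0); ring.
Qed.

End Real.

(** * Comparison of covolumes *)

Lemma haar_measure_left (R : realType) (K : numFieldType) (n : nat)
    (mu : {measure set (borel (SL K n)) -> \bar R}) : haar_measure mu ->
  forall (g : SL K n) (A : set (SL K n)), measurable (A : set (borel (SL K n))) ->
    mu [set (g * a)%g | a in A] = mu A.
Proof. by case. Qed.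

Lemma exists_fundamental_set_cinv_Gamma (R : realType) :
  exists F, fundamental_set (cinv_Gamma R) F.
Proof.
apply: (exists_fundamental_set (@rat_complex_dense R)).
  exact: subgroup_cinv_Gamma.
exists (1 / 8) => [|g /cinv_Gamma_half_sqr]; first by rewrite divr_gt0.
exact: half_sqr_gauss_discrete.
Qed.

Lemma exists_fundamental_set_cinv_Gamma_int (R : realType) :
  exists F, fundamental_set (cinv_Gamma_int R) F.
Proof.
apply: (exists_fundamental_set (@rat_dense R)).
  exact: subgroup_cinv_Gamma_int.
by apply: half_sqr_int_discrete => g /cinv_Gamma_intP /cinv_Gamma_half_sqr.
Qed.

Lemma exists_fundamental_set_SL2_int (R : realType) :
  exists F, fundamental_set (SL2_int R) F.
Proof.
apply: (exists_fundamental_set (@rat_dense R)); first exact: subgroup_SL2_int.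
apply: half_sqr_int_discrete => g Sg i j.
have O2 := gauss2 R; have : gaussian_int (SL_complex g i j).
  by rewrite SL_complexE; apply/gauss_real.
by rewrite expr2 => ?; gauss.
Qed.

(** With h F fundamental for [SL2_ext], the union of h F and z h F is fundamental for SL_2(Z[i]), of
    index two. The sum form of the identity makes sense for infinite masses too. *)
Lemma cinv_Gamma_covolume (R : realType)
    (mu : {measure set (borel (SL R[i] 2)) -> \bar R})
    (nu : {measure set (borel (left_quotient (cinv_Gamma R))) -> \bar R})
    (nu' : {measure set (borel (left_quotient (SL2_gauss R))) -> \bar R}) :
  haar_measure mu -> induced_measure mu nu -> induced_measure mu nu' ->
  nu' setT = (nu setT + nu setT)%E.
Proof.
move=> /haar_measure_left mu_left ind ind'.
have [F fF] := exists_fundamental_set_cinv_Gamma R.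
rewrite (induced_measureT (subgroup_cinv_Gamma R) fF ind).
have zz := @zeta_sqr R; have II := @sqrI R.
(* Since zeta^2 = i, the inverse of zeta is - i zeta, so z is diag(zeta, zeta^-1). *)
have dz : zeta R * (- 'i%C * zeta R) - 0 * 0 = 1 by ring: zz II.
pose z : SL R[i] 2 := SL2_of dz.
have zE : SL2_zeta z.
  apply/(forall22 (@zeta_gauss R)); rewrite !SL2_ofE; split.
  - by exists 1; [exact: gauss1|rewrite mulr1].
  - by exists 0; [exact: gauss0|rewrite mulr0].
  - by exists 0; [exact: gauss0|rewrite mulr0].
  - by exists (- 'i%C); [apply: gaussN; exact: gaussI|rewrite mulrC].
pose h : SL R[i] 2 := (latt R)^-1%g.
have fF' : fundamental_set (@SL2_ext R) [set (h * a)%g | a in F].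
  apply: fundamental_set_conj fF => x.
  by rewrite cinv_GammaP /latt_conj /h invgK !mulgA mulVg mul1g mulgVK.
pose t i : SL R[i] 2 := if i == 0%N then 1%g else z.
have tL i : (i < 2)%N -> SL2_ext (t i).
  case: i => [|i] _; first exact: (subgroup_SL2_ext R).1.
  by right.
have tinj i j : (i < 2)%N -> (j < 2)%N -> SL2_gauss R (t i * (t j)^-1)%g -> i = j.
  have zN : ~ SL2_gauss R z.
    by move=> /(_ 0 0); rewrite SL2_ofE; apply: zeta_notin.
  case: i j => [|[|//]] [|[|//]] // _ _ /=.
    by move=> /(subgroupV (subgroup_SL2_gauss R)); rewrite invgM invgK /t /= invg1 mulg1.
  by rewrite /t /= invg1 mulg1.
have sG := subgroup_SL2_gauss R; have sE := subgroup_SL2_ext R.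
have fU := fundamental_set_cosets sE sG (@subsetUl _ _ _) fF' tL _ tinj.
rewrite (induced_measureT sG (fU _) ind'); last first.
  move=> l [Ol|zl]; first by exists 0%N => //; rewrite /t /= invg1 mulg1.
  exists 1%N => //= i j; rewrite mulSL2E.
  have {}zE := forall22V (@zeta_gaussN R) zE.
  by apply: gaussD; apply: zeta_zetaM.
rewrite (measure_cosets mu_left sE fF' tL); last first.
  by move=> i j i2 j2 tij; apply: tinj => //; rewrite tij mulgV; apply: sG.1.
by rewrite !big_ord_recr big_ord0 /= add0e mu_left //; case: fF.
Qed.

(** The theta group has index 2 in c^-1(Gamma_Z) and index 3 in SL_2(Z). Two translates of F and
    three of F' thus give two fundamental sets of the theta group, which have equal measure. *)
Lemma cinv_Gamma_int_covolume (R : realType)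
    (mu : {measure set (borel (SL R 2)) -> \bar R})
    (nu : {measure set (borel (left_quotient (cinv_Gamma_int R))) -> \bar R})
    (nu' : {measure set (borel (left_quotient (SL2_int R))) -> \bar R}) :
  haar_measure mu -> induced_measure mu nu -> induced_measure mu nu' ->
  (nu setT + nu setT = nu' setT + nu' setT + nu' setT)%E.
Proof.
move=> /haar_measure_left mu_left ind ind'.
have [F fF] := exists_fundamental_set_cinv_Gamma_int R.
have [F' fF'] := exists_fundamental_set_SL2_int R.
have sL := subgroup_cinv_Gamma_int R; have sZ := subgroup_SL2_int R.
have sT := subgroup_theta R.
rewrite (induced_measureT sL fF ind) (induced_measureT sZ fF' ind').
pose k := theta_normalizer R; have Lk := theta_normalizer_cinv_Gamma_int R.
(* The inverse of k is chosen because l t_1^-1 is then l k, as in [cinv_Gamma_int_theta]. *)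
pose t i : SL R 2 := if i == 0%N then 1%g else (k^-1)%g.
have tL i : (i < 2)%N -> cinv_Gamma_int R (t i).
  by case: i => [|i] _; [exact: sL.1|exact: subgroupV sL Lk].
have tinj i j : (i < 2)%N -> (j < 2)%N -> theta (t i * (t j)^-1)%g -> i = j.
  case: i j => [|[|//]] [|[|//]] // _ _; rewrite /t /= ?invg1 ?invgK ?mulg1 ?mul1g.
    by move/theta_normalizer_notin.
  by move/(subgroupV sT); rewrite invgK => /theta_normalizer_notin.
have tcov l : cinv_Gamma_int R l ->
    exists2 i, (i < 2)%N & theta (l * (t i)^-1)%g.
  case/cinv_Gamma_int_theta => H; first by exists 0%N; rewrite // /t /= invg1 mulg1.
  by exists 1%N; rewrite // /t /= invgK.
have cT : countable (@theta R).
  by apply: sub_countable (countable_SL2_int R); apply: subset_card_le => g [].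
have fU := fundamental_set_cosets sL sT (@theta_cinv_Gamma_int R) fF tL tcov tinj.
have fU' := fundamental_set_cosets sZ sT (fun g H => H.1) fF'
  (fun i _ => theta_reps_int R i) (@theta_reps_cover R) (@theta_reps_inj R).
have := measure_fundamental_set mu_left sT cT fU fU'.
rewrite (measure_cosets mu_left sL fF tL); last first.
  by move=> i j i2 j2 tij; apply: tinj => //; rewrite tij mulgV; apply: sT.1.
rewrite (measure_cosets mu_left sZ fF' (fun i _ => theta_reps_int R i)); last first.
  by move=> i j i3 j3 tij; apply: (@theta_reps_inj R) => //; rewrite tij mulgV; apply: sT.1.
by rewrite !big_ord_recr !big_ord0 /= !add0e.
Qed.

Theorem proposition1p4p2p2 (R : realType) :
  (forall (mu : {measure set (borel (SL R[i] 2)) -> \bar R})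
     (nu : {measure set (borel (left_quotient (cinv_Gamma R))) -> \bar R})
     (nu' : {measure set (borel (left_quotient (SL2_gauss R))) -> \bar R}),
     haar_measure mu -> induced_measure mu nu -> induced_measure mu nu' ->
     nu setT = ((1 / 2)%:E * nu' setT)%E)
  /\
  (forall (mu : {measure set (borel (SL R 2)) -> \bar R})
     (nu : {measure set (borel (left_quotient (cinv_Gamma_int R))) -> \bar R})
     (nu' : {measure set (borel (left_quotient (SL2_int R))) -> \bar R}),
     haar_measure mu -> induced_measure mu nu -> induced_measure mu nu' ->
     nu setT = ((3 / 2)%:E * nu' setT)%E).
Proof.
(* Halving is justified by distributivity for nonnegative extended reals, so finiteness of the
   masses is not at issue. *)
have half (x : \bar R) : (0 <= x)%E -> ((1 / 2)%:E * (x + x) = x)%E.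
  move=> x0; rewrite ge0_muleDr // -ge0_muleDl ?lee_fin ?divr_ge0 // -EFinD.
  by rewrite (_ : 1 / 2 + 1 / 2 = 1) ?mul1e //; field.
split=> mu nu nu' hmu ind ind'.
  by rewrite (cinv_Gamma_covolume hmu ind ind') half ?measure_ge0.
rewrite -[LHS]half ?measure_ge0 // (cinv_Gamma_int_covolume hmu ind ind').
have h0 : (0 <= (1 / 2 : R)%:E)%E by rewrite lee_fin divr_ge0.
rewrite !ge0_muleDr ?adde_ge0 ?measure_ge0 // -!ge0_muleDl ?adde_ge0 //.
by rewrite -!EFinD; congr (_%:E * _)%E; field.
Qed.
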